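(* Let $E,A\in\mathbb{R}^{n\times n}$, $B\in\mathbb{R}^{n\times m}$, $C\in\mathbb{R}^{m\times n}$, $D\in\mathbb{R}^{m\times m}$, and let $\Sigma=(E,A,B,C,D)$ denote the linear time-invariant system $E\dot x(t)=Ax(t)+Bu(t)$, $y(t)=Cx(t)+Du(t)$. Then the following are equivalent. 1. $\Sigma$ is admissible and extended strictly positive real (ESPR), and $D+D^T\succ 0$. 2. There exists $X\in\mathbb{R}^{n\times n}$ such that $$\begin{bmatrix} A^TX+X^TA & X^TB-C^T\\ B^TX-C & -D-D^T\end{bmatrix}\prec 0\quad\text{and}\quad E^TX=X^TE\succeq 0.$$ 3. $\Sigma$ admits a port-Hamiltonian form (PH-form) with positive definite cost matrix.
   Context: For a real symmetric (or complex Hermitian) matrix $M$, $M\succ0$ (resp. $M\succeq0$) means that $M$ is positive definite (resp. positive semidefinite), and $M\prec 0$ means $-M\succ0$; in particular, writing $M\succeq 0$ for a real matrix includes the requirement that $M$ is symmetric. The imaginary unit is $j$, and ${}^*$ is the conjugate transpose. Admissibility. The pair $(E,A)$ (and the system) is regular if $\det(\lambda E-A)\ne0$ for some $\lambda\in\mathbb{C}$. For a regular pair, the finite eigenvalues are the roots of the polynomial $\det(zE-A)$. A regular pair has a Weierstrass canonical form: there exist nonsingular $W,T\in\mathbb{C}^{n\times n}$ with $E=W\begin{bmatrix} I_q&0\\0&N\end{bmatrix}T$, $A=W\begin{bmatrix} J&0\\0&I_{n-q}\end{bmatrix}T$, where $J$ is in Jordan form (its eigenvalues being the $q$ finite eigenvalues)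 and $N$ is a nilpotent matrix in Jordan form. If $q<n$, the index of the pair is the degree of nilpotency $\nu\ge1$ of $N$ ($N^\nu=0$, $N^{i}\neq0$ for $i=1,\dots,\nu-1$); if $E$ is nonsingular, the index is $0$. The pair is asymptotically stable if all its finite eigenvalues lie in the open left half plane. The pair (and the system) is admissible if it is regular, of index at most one, and asymptotically stable. Positive realness. For a regular system the transfer function is $G(s)=C(sE-A)^{-1}B+D$, $s\in\mathbb{C}$. The system is strictly positive real (SPR) if (a) $G$ has no pole in $\{\mathrm{Re}\,s\ge0\}$, and (b) $G(jw)+G(jw)^*\succ0$ for all $w\in[0,\infty)$. It is extended strictly positive real (ESPR) if it is SPR and $G(j\infty)+G(j\infty)^*\succ0$, where $G(j\infty)$ denotes the value of $G$ at infinity (the limit of $G(jw)$ as $w\to\infty$). PH-form. The system $(E,A,B,C,D)$ admits a PH-form if there exist real matrices $J,R,Q\in\mathbb{R}^{n\times n}$, $F,P\in\mathbb{R}^{n\times m}$, $S,N\in\mathbb{R}^{m\times m}$ such that $A=(J-R)Q$, $B=F-P$, $C=(F+P)^TQ$, $D=S+N$, where $J^T=-J$, $N^T=-N$, $Q$ is invertible, $Q^TE=E^TQ\succeq0$, $R\succeq 0$, $S\succeq 0$, and the cost matrix $K=\begin{bmatrix} R&P\\P^T&S\end{bmatrix}$ satisfies $K\succeq0$. It admits a PH-form with positive definite cost matrix if these matrices can be chosen with $K\succ0$. *)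

(* Defs.v *)
From mathcomp Require Import all_boot all_order all_algebra.
From mathcomp Require Import spectral fraction complex.
From mathcomp Require Import boolp classical_sets filter reals topology normedtype.
Set Implicit Arguments.
Unset Strict Implicit.
Unset Printing Implicit Defensive.
Import Order.TTheory GRing.Theory Num.Theory.
Import numFieldNormedType.Exports.
Local Open Scope classical_set_scope.
Local Open Scope ring_scope.
Local Open Scope complex_scope.
Local Open Scope sesquilinear_scope.

Section Definiteness.
Variable R : realType.

Definition posdefmx k (M : 'M[R]_k) : Prop :=
  M^T = M /\ forall x : 'cV[R]_k, x != 0 -> 0 < (x^T *m M *m x) 0 0.

Definition possemidefmx k (M : 'M[R]_k) : Prop :=
  M^T = M /\ forall x : 'cV[R]_k, 0 <= (x^T *m M *m x) 0 0.

Definition negdefmx k (M : 'M[R]_k) : Prop := posdefmx (- M).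

(* In [R[i]], [0 < z] means that [z] is real and positive. *)
Definition hermposdefmx k (M : 'M[R[i]]_k) : Prop :=
  M ^t* = M /\ forall x : 'cV[R[i]]_k, x != 0 -> 0 < (x ^t* *m M *m x) 0 0.

End Definiteness.

Section RationalFunctions.
Variable F : fieldType.
Implicit Types f : {fraction {poly F}}.

(* The representative of a fraction need not be in lowest terms, hence the
   division by the gcd; poles and values are read off the reduced form. *)
Definition frac_gcd f : {poly F} := gcdp (repr f).1 (repr f).2.
Definition rat_num f : {poly F} := (repr f).1 %/ frac_gcd f.
Definition rat_den f : {poly F} := (repr f).2 %/ frac_gcd f.

Definition is_pole f (s : F) : Prop := root (rat_den f) s.

(* Meaningful only where [f] has no pole. *)
Definition rat_eval f (s : F) : F := (rat_num f).[s] / (rat_den f).[s].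

End RationalFunctions.

Section Pencils.
Variables (R : realType) (n : nat).
Implicit Types E A : 'M[R]_n.

Definition complexmx p q (M : 'M[R]_(p, q)) : 'M[R[i]]_(p, q) :=
  map_mx (fun a : R => a%:C) M.

Definition regular E A : Prop :=
  exists lambda : R[i], \det (lambda *: complexmx E - complexmx A) != 0.

(* The polynomial matrix [zE - A], with ['X] in the role of [z]. *)
Definition pencil E A : 'M[{poly R[i]}]_n :=
  'X *: map_mx polyC (complexmx E) - map_mx polyC (complexmx A).

Definition finite_eigenvalue E A (s : R[i]) : Prop :=
  root (\det (pencil E A)) s.

Definition asymptotically_stable E A : Prop :=
  forall s : R[i], finite_eigenvalue E A s -> complex.Re s < 0.

(* Entrywise form of "block diagonal with upper Jordan blocks": a 1 on the
   superdiagonal joins two equal diagonal entries of the same block, a 0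
   separates two blocks. *)
Definition jordan_form k (M : 'M[R[i]]_k) : Prop :=
  forall i j : 'I_k,
    (j != i -> j != i.+1 :> nat -> M i j = 0) /\
    (j = i.+1 :> nat -> M i j = 0 \/ (M i j = 1 /\ M i i = M j j)).

Definition nilpotent_mx k (N : 'M[R[i]]_k) : Prop := exists d, N ^+ d = 0.

Definition weierstrass_form E A q r (qr : (q + r = n)%N) (W T : 'M[R[i]]_n)
    (J : 'M[R[i]]_q) (N : 'M[R[i]]_r) : Prop :=
  [/\ W \in unitmx /\ T \in unitmx,
      complexmx E = W *m castmx (qr, qr) (block_mx 1%:M 0 0 N) *m T,
      complexmx A = W *m castmx (qr, qr) (block_mx J 0 0 1%:M) *m T,
      jordan_form J
    & jordan_form N /\ nilpotent_mx N].

Definition has_index E A (nu : nat) : Prop :=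
  (E \in unitmx /\ nu = 0%N) \/
  (E \notin unitmx /\
   exists (q r : nat) (qr : (q + r = n)%N) (W T : 'M[R[i]]_n)
          (J : 'M[R[i]]_q) (N : 'M[R[i]]_r),
     [/\ weierstrass_form E A qr W T J N, (1 <= nu)%N, N ^+ nu = 0
       & forall i : nat, (1 <= i < nu)%N -> N ^+ i <> 0]).

Definition admissible E A : Prop :=
  [/\ regular E A, exists2 nu, has_index E A nu & (nu <= 1)%N
    & asymptotically_stable E A].

End Pencils.

Section Systems.
Variables (R : realType) (n m : nat).
Variables (E A : 'M[R]_n) (B : 'M[R]_(n, m)) (C : 'M[R]_(m, n)) (D : 'M[R]_m).

Definition ratmx p q (M : 'M[R]_(p, q)) : 'M[{fraction {poly R[i]}}]_(p, q) :=
  map_mx (fun a => FracField.tofrac a%:P) (complexmx M).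

(* [C (sE - A)^-1 B + D] as a matrix of rational functions of [s]. *)
Definition transfer : 'M[{fraction {poly R[i]}}]_m :=
  ratmx C *m invmx (map_mx (fun p => FracField.tofrac p) (pencil E A)) *m ratmx B
  + ratmx D.

Definition transfer_pole (s : R[i]) : Prop :=
  exists i j, is_pole (transfer i j) s.

Definition transfer_at (s : R[i]) : 'M[R[i]]_m :=
  map_mx (fun f => rat_eval f s) transfer.

(* [L] is the limit of [G(jw)] as [w] tends to infinity, entry by entry and
   separately in the real and the imaginary parts. *)
Definition transfer_at_infinity (L : 'M[R[i]]_m) : Prop :=
  forall i j,
    complex.Re (transfer_at (0 +i* w) i j) @[w --> +oo] --> complex.Re (L i j)
 /\ complex.Im (transfer_at (0 +i* w) i j) @[w --> +oo] --> complex.Im (L i j).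

Definition strictly_positive_real : Prop :=
  [/\ regular E A,
      forall s : R[i], 0 <= complex.Re s -> ~ transfer_pole s
    & forall w : R, 0 <= w ->
        hermposdefmx (transfer_at (0 +i* w) + (transfer_at (0 +i* w)) ^t*)].

Definition extended_strictly_positive_real : Prop :=
  strictly_positive_real /\
  exists2 L : 'M[R[i]]_m, transfer_at_infinity L & hermposdefmx (L + L ^t*).

Definition cost_matrix (Rm : 'M[R]_n) (P : 'M[R]_(n, m)) (S : 'M[R]_m) :
    'M[R]_(n + m) :=
  block_mx Rm P P^T S.

Definition ph_form (J Rm Q : 'M[R]_n) (F P : 'M[R]_(n, m)) (S N : 'M[R]_m) :
    Prop :=
  [/\ [/\ A = (J - Rm) *m Q, B = F - P, C = (F + P)^T *m Q & D = S + N],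
      J^T = - J /\ N^T = - N,
      Q \in unitmx,
      Q^T *m E = E^T *m Q /\ possemidefmx (Q^T *m E)
    & [/\ possemidefmx Rm, possemidefmx S & possemidefmx (cost_matrix Rm P S)]].

Definition admits_ph_form_posdef_cost : Prop :=
  exists (J Rm Q : 'M[R]_n) (F P : 'M[R]_(n, m)) (S N : 'M[R]_m),
    ph_form J Rm Q F P S N /\ posdefmx (cost_matrix Rm P S).

End Systems.

(* Main.v *)
Require Import Defs.
From mathcomp Require Import all_boot all_order all_algebra reals.
From mathcomp Require Import generic_quotient spectral fraction complex.
From mathcomp Require Import zify lra.
From mathcomp Require Import boolp classical_sets filter topology normedtype.
Set Implicit Arguments.
Unset Strict Implicit.
Unset Printing Implicit Defensive.
Import Order.TTheory GRing.Theory Num.Theory.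
Import numFieldNormedType.Exports.
Local Open Scope ring_scope.
Local Open Scope sesquilinear_scope.

(* The heart of the matter is (1) => (2).  If no X with E^T X symmetric makes
   the matrix inequality strict, separation in the space of symmetric matrices
   yields a nonzero positive semidefinite certificate Z = W W^*, W = [G; U],
   orthogonal to all the terms linear in X and nonnegative against the constant
   one.  Orthogonality makes (F, E G) a skew pair, F G^* E^* + E G F^* = 0 with
   F = A G + B U (U reduced to the row space of G), so that in a suitable
   unitary basis of columns every vector v has F v = i w E G v for a real w, or
   E G v = 0: the certificate splits into trajectories of the system at finite
   frequencies and at infinity, on which strict positive realness makes the
   supplied power positive, and into pure inputs, on which D + D^T > 0 does.
   Hence Z = 0, a contradiction.  The sign of E^T X comes from Lyapunov's
   theorem, proved by induction on a triangular form of the finite part.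

   For (2) => (1) the same power balance is read backwards; the Jordan form of
   the finite part, required by the Weierstrass form, is obtained by splitting
   off one longest chain at a time.  (2) <=> (3) is a congruence, with Q = X. *)

(** * Jordan normal form *)

(** The ranks are bounded, so they cannot drop forever; the least exponent without a drop has strict
    drops before it. *)
Lemma rank_exp_stabilizes (F : fieldType) k (N : 'M[F]_k.+1) :
  exists s, \rank (N ^+ s.+1) = \rank (N ^+ s) /\
    forall t, (t < s)%N -> (\rank (N ^+ t.+1) < \rank (N ^+ t))%N.
Proof.
have le t : (\rank (N ^+ t.+1) <= \rank (N ^+ t))%N.
  by rewrite exprS; apply: mxrankM_maxr.
have [s Ps] : exists s, \rank (N ^+ s.+1) == \rank (N ^+ s).
  apply: contrapT => H.
  have lt t : (\rank (N ^+ t.+1) < \rank (N ^+ t))%N.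
    by rewrite ltn_neqAle le andbT; apply/negP => e; apply: H; exists t.
  have bnd t : (\rank (N ^+ t) + t <= k.+1)%N.
    elim: t => [|t IH]; first by rewrite addn0 rank_leq_row.
    by rewrite addnS; apply: leq_trans IH; rewrite ltn_add2r.
  by have := bnd k.+2; rewrite leqNgt ltn_addl.
pose Q t := \rank (N ^+ t.+1) == \rank (N ^+ t).
have exQ : exists t, Q t by exists s.
case: (ex_minnP exQ) => u /eqP eu mn; exists u; split=> // t tu.
by rewrite ltn_neqAle le andbT; apply: contraL tu => /mn; rewrite -leqNgt.
Qed.

(* Fitting: at the index [s.+1] where the ranks of the powers of [N] stabilize
   the kernel and the image of [N ^+ s.+1] are independent, which provides a
   linear form killed by [N ^+ s.+1] and nonzero on the end of a longest
   chain. *)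
Lemma dual_chains (F : fieldType) k (N : 'M[F]_k.+1) : N \notin unitmx ->
  exists s (v : 'rV[F]_k.+1) (phi : 'cV[F]_k.+1),
    [/\ v *m N ^+ s.+1 = 0, N ^+ s.+1 *m phi = 0 & v *m N ^+ s *m phi != 0].
Proof.
(* Exponent 0 is excluded because [N] is singular; the index is thus [s.+1], and the last strict
   drop is from [s] to [s.+1]. *)
move=> Nu; have [[|s] [rks rkt]] := rank_exp_stabilizes N.
  move: Nu; rewrite -row_free_unit /row_free; move: rks.
  by rewrite expr1 expr0 mxrank1 => ->; rewrite eqxx.
exists s.
have rkk t : \rank (kermx (N ^+ t)) = (k.+1 - \rank (N ^+ t))%N.
  by rewrite mxrank_ker.
have subk t : (kermx (N ^+ t) <= kermx (N ^+ t.+1))%MS.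
  by apply/sub_kermxP; rewrite exprSr mulmxA mulmx_ker mul0mx.
have /row_subPn[i Hi] : ~~ (kermx (N ^+ s.+1) <= kermx (N ^+ s))%MS.
  apply/negP => /mxrankS; rewrite !rkk leqNgt ltn_sub2l ?rkt //.
  by apply: leq_trans (rkt s _) _ => //; apply: rank_leq_row.
pose v := row i (kermx (N ^+ s.+1)).
have v0 : v *m N ^+ s.+1 = 0 by apply/sub_kermxP; apply: row_sub.
have w0 : v *m N ^+ s != 0 by apply: contra Hi => /eqP e; apply/sub_kermxP.
(* If [v N^s] were [y N^(s+1)], then [y] would be killed by [N^(s+2)], hence already by [N^(s+1)],
   and [v N^s] would vanish. *)
have : v *m N ^+ s *m cokermx (N ^+ s.+1) != 0.
  apply: contra w0 => /eqP; rewrite -mulmxA => e.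
  have : (v *m N ^+ s <= N ^+ s.+1)%MS by rewrite submxE -mulmxA e.
  case/submxP => y ey; rewrite ey; apply/eqP/sub_kermxP.
  have le2 : (kermx (N ^+ s.+2) <= kermx (N ^+ s.+1))%MS.
    by rewrite -(mxrank_leqif_sup (subk s.+1)).2 !rkk rks.
  apply: submx_trans le2; apply/sub_kermxP.
  by rewrite exprSr mulmxA -ey -mulmxA mulmxE -exprSr.
case/matrix0Pn => a [j Hj].
exists v, (col j (cokermx (N ^+ s.+1))); split=> //.
  by rewrite colE mulmxA mulmx_coker mul0mx.
by apply/matrix0Pn; exists a, ord0; rewrite colE mulmxA -colE mxE.
Qed.

(** Entry [(i, j)] of the product is [v N^(i + s - j) phi]: zero for [i > j] and [v N^s phi] on the
    diagonal, so the matrix is triangular and invertible. *)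
Lemma chain_gram_unit (F : fieldType) n (N : 'M[F]_n) s (v : 'rV_n) (phi : 'cV_n) :
    v *m N ^+ s.+1 = 0 -> v *m N ^+ s *m phi != 0 ->
  (\matrix_(i < s.+1) (v *m N ^+ i)) *m (\matrix_(j < s.+1) (N ^+ (s - j) *m phi)^T)^T
    \in unitmx.
Proof.
move=> v0 w0; rewrite unitmxE -det_tr; set G := (_ *m _)^T.
have GE i j : G i j = (v *m N ^+ (j + (s - i)) *m phi) 0 0.
  rewrite /G mxE mxE exprD -mulmxE mulmxA -[in RHS](mulmxA _ _ phi) [RHS]mxE.
  by apply: eq_bigr => l _; rewrite mxE mxE; congr (_ * _); do 3!rewrite mxE.
rewrite det_trig; last first.
  apply/is_trig_mxP => i j ij; rewrite GE.
  have -> : (j + (s - i) = s.+1 + (j - i.+1))%N.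
    have := ltn_ord i; rewrite ltnS => is_; lia.
  by rewrite exprD -mulmxE !mulmxA v0 !mul0mx mxE.
rewrite unitfE; apply/prodf_neq0 => i _; rewrite GE.
rewrite subnKC; last by rewrite -ltnS.
by apply: contra w0 => /eqP e; apply/eqP/matrixP => a b; rewrite !ord1 e mxE.
Qed.

Definition shift_mx (F : pzRingType) s : 'M[F]_s := \matrix_(i, j) (j == i.+1 :> nat)%:R.

(** The chain [v N^i] spans an invariant subspace, and the annihilator of the dual chain [N^i phi]
    is another one; invertibility of the Gram matrix of the two chains makes these subspaces
    complementary. *)
Lemma chain_splits (F : fieldType) s t (N : 'M[F]_(s.+1 + t))
    (v : 'rV_(s.+1 + t)) (phi : 'cV_(s.+1 + t)) :
    v *m N ^+ s.+1 = 0 -> N ^+ s.+1 *m phi = 0 -> v *m N ^+ s *m phi != 0 ->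
  exists P (M' : 'M_t), P \in unitmx /\ P *m N = block_mx (shift_mx F s.+1) 0 0 M' *m P.
Proof.
move=> v0 phi0 w0; have := chain_gram_unit v0 w0.
set V := \matrix_i _; set Phi := (\matrix_j _)^T => VPu.
have rkPhi : \rank Phi = s.+1.
  apply/eqP; rewrite eqn_leq rank_leq_col /=.
  by rewrite -[leqLHS](mxrank_unit VPu) mxrankM_maxr.
have [K [Kf Ke]] : exists K : 'M_(t, s.+1 + t), row_free K /\ (K :=: kermx Phi)%MS.
  have : \rank (kermx Phi) = t by rewrite mxrank_ker rkPhi addKn.
  move: (row_base_free (kermx Phi)) (eq_row_base (kermx Phi)).
  by move: (row_base _) => + + + e; rewrite e => K; exists K.
have KN i : K *m N ^+ i *m phi = 0.
  case: (leqP i s) => si; last first.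
    by rewrite -(subnK si) exprD -mulmxE -!mulmxA phi0 !mulmx0.
  have /sub_kermxP KPhi : (K <= kermx Phi)%MS by rewrite Ke.
  have : col (inord (s - i)) (K *m Phi) = 0 by rewrite KPhi col0.
  rewrite colE -mulmxA -colE -mulmxA => <-; congr (_ *m _).
  by rewrite /Phi -tr_row rowK trmxK inordK ?ltnS ?leq_subr // subKn.
have /submxP[M' M'E] : (K *m N <= K)%MS.
  rewrite Ke; apply/sub_kermxP/matrixP => i j; rewrite [RHS]mxE.
  have /matrixP/(_ i 0) := KN (s - j).+1; rewrite [RHS]mxE => <-.
  rewrite exprS -mulmxE mulmxA -[in RHS]mulmxA !mxE.
  by apply: eq_bigr => l _; rewrite !mxE.
exists (col_mx V K), M'; split; last first.
  rewrite mul_block_col mul_col_mx !mul0mx addr0 add0r -M'E; congr col_mx.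
  apply/row_matrixP => i; rewrite row_mul rowK row_mul -mulmxA mulmxE -exprSr.
  case: (ltnP i s) => si; last first.
    have e : i.+1 = s.+1 by apply/eqP; rewrite eqn_leq ltn_ord ltnS.
    rewrite e v0 (_ : row i _ = 0) ?mul0mx //; apply/rowP => j; rewrite !mxE.
    by rewrite e eqn_leq [(s < j)%N]leqNgt ltn_ord andbF.
  have -> : row i (shift_mx F s.+1) = delta_mx 0 (inord i.+1).
    apply/rowP => j; rewrite !mxE /= -val_eqE /= inordK //.
  by rewrite -rowE rowK inordK.
(* Multiplying a relation between the rows by [Phi] removes the part along [K]; the Gram matrix then
   kills the coefficients along [V], and [K] is free. *)
rewrite -row_free_unit -kermx_eq0.
apply/rowV0P => x /sub_kermxP; rewrite -[x]hsubmxK mul_row_col => e.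
have /sub_kermxP KPhi : (K <= kermx Phi)%MS by rewrite Ke.
have l0 : lsubmx x = 0.
  have : (lsubmx x *m V + rsubmx x *m K) *m Phi = 0 by rewrite e mul0mx.
  rewrite mulmxDl -!mulmxA KPhi mulmx0 addr0 => /(canRL (mulmxK VPu)).
  by rewrite mul0mx.
move: e; rewrite l0 mul0mx add0r => /(canRL (mulmxKp Kf)); rewrite mul0mx => ->.
by rewrite row_mx0.
Qed.

Lemma jordan_form_shift (R : realType) s t (l : R[i]) (J : 'M[R[i]]_t) :
  jordan_form J -> jordan_form (block_mx (shift_mx _ s + l%:M) 0 0 J).
Proof.
move=> HJ i j; rewrite -(splitK i) -(splitK j).
case: (split i) => i'; case: (split j) => j'; rewrite /unsplit
  ?(block_mxEul, block_mxEur, block_mxEdl, block_mxEdr) ?mxE.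
- rewrite /= !eqxx (ltn_eqF (ltnSn i')) (ltn_eqF (ltnSn j')).
  split=> [ne1 ne2|e]; last by right; rewrite e eqxx -val_eqE /= e ltn_eqF ?addr0.
  have /negPf-> : i' != j' by apply: contra ne1 => /eqP->.
  by rewrite (negPf (ne2 : j' != i'.+1 :> nat)) addr0.
- by split=> // _; left.
- by split=> // _; left.
- have [a b] := HJ i' j'; split=> [ne1 ne2|].
    apply: a; first by apply: contra ne1 => /eqP->.
    by apply: contra ne2 => /eqP /= ->; rewrite addnS.
  by rewrite /= -addnS => /addnI; exact: b.
Qed.

Lemma block_diag_intertwine (F : fieldType) s t (M P : 'M[F]_(s + t)) N M' (Q J : 'M_t) l :
    P *m (M - l%:M) = block_mx N 0 0 M' *m P -> Q *m (M' + l%:M) = J *m Q ->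
  block_mx 1%:M 0 0 Q *m P *m M =
  block_mx (N + l%:M) 0 0 J *m (block_mx 1%:M 0 0 Q *m P).
Proof.
move=> PM QM; have -> : M = (M - l%:M) + l%:M by rewrite subrK.
rewrite -mulmxA mulmxDr PM mul_mx_scalar -mul_scalar_mx -mulmxDl !mulmxA.
congr (_ *m _); rewrite scalar_mx_block add_block_mx !addr0.
by rewrite !mulmx_block !mul0mx !mulmx0 !mul1mx !mulmx1 !addr0 !add0r QM.
Qed.

(** Strong induction on the size: a longest chain of [M - l], for an eigenvalue [l], becomes a
    Jordan block, and the complementary block, shifted back by [l], falls under the induction
    hypothesis. *)
Theorem jordan_exists (R : realType) k (M : 'M[R[i]]_k) :
  exists P J, [/\ P \in unitmx, P *m M = J *m P & jordan_form J].
Proof.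
elim/ltn_ind: k M => -[|k] IH M.
  by exists 1%:M, M; split; [rewrite unitmx1|rewrite mul1mx mulmx1|case].
have [|l /eigenvalueP[w wM w0]] := @eigenvalue_closed _ _ M; first by [].
have [|s [v [phi [v0 phi0 vphi0]]]] := @dual_chains _ _ (M - l%:M).
  apply/negP => u; move: w0.
  have : w *m (M - l%:M) = 0 by rewrite mulmxBr wM mul_mx_scalar subrr.
  by move=> /(canRL (mulmxK u)) ->; rewrite mul0mx eqxx.
have sk : (s <= k)%N.
  have := chain_gram_unit v0 vphi0.
  move=> /mxrank_unit e; rewrite -ltnS -[s.+1]e.
  exact: leq_trans (mxrankM_maxl _ _) (rank_leq_col _).
pose t := (k - s)%N; have kE : k = (s + t)%N by rewrite subnKC.
move: t kE => t kE; subst k.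
have [P [M' [Pu PM]]] := @chain_splits _ s t (M - l%:M) v phi v0 phi0 vphi0.
have [|Q [J [Qu QM HJ]]] := IH t _ (M' + l%:M); first by rewrite ltnS leq_addl.
exists (block_mx 1%:M 0 0 Q *m P : 'M_(s.+1 + t)).
exists (block_mx (shift_mx _ s.+1 + l%:M) 0 0 J : 'M_(s.+1 + t)).
split; last exact: (@jordan_form_shift R s.+1 t l J HJ).
  by rewrite unitmx_mul Pu andbT (@unitmxE _ (s.+1 + t)) det_ublock det1 mul1r.
exact: (@block_diag_intertwine _ s.+1 t M P _ _ _ _ l PM QM).
Qed.

(** * A separation theorem for cones of symmetric matrices *)

Section Sublinear.
Local Open Scope classical_set_scope.
Variables (R : realType) (V : lmodType R).
Implicit Types (p q : V -> R) (x y v : V).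

Definition sublinear p :=
  (forall x y, p (x + y) <= p x + p y) /\
  (forall a x, 0 < a -> p (a *: x) = a * p x).

Lemma sublinear0 p : sublinear p -> p 0 = 0.
Proof.
case=> _ /(_ 2 0 (ltr0Sn _ 1)); rewrite scaler0 => e.
by apply: (@addrI _ (p 0)); rewrite addr0 [RHS]e mulr2n mulrDl mul1r.
Qed.

Lemma sublinearN p x : sublinear p -> - p x <= p (- x).
Proof.
move=> sp; rewrite -subr_ge0 opprK; have [/(_ (- x) x)] := sp.
by rewrite addNr sublinear0.
Qed.

Lemma inf_sublinear (S : V -> set R) :
    (forall x, S x !=set0) -> (forall x, has_lbound (S x)) ->
    (forall x y t u, S x t -> S y u -> S (x + y) (t + u)) ->
    (forall a x t, 0 < a -> S x t -> S (a *: x) (a * t)) ->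
  sublinear (fun x => inf (S x)).
Proof.
move=> S0 Sb SD SZ.
have leZ a x : 0 < a -> inf (S (a *: x)) <= a * inf (S x).
  move=> a0; rewrite -ler_pdivrMl //; apply: lb_le_inf => // t St.
  by rewrite ler_pdivrMl //; apply: ge_inf => //; apply: SZ.
split=> [x y|a x a0].
  rewrite -lerBlDr; apply: lb_le_inf => // t St.
  rewrite lerBlDr -lerBlDl; apply: lb_le_inf => // u Su.
  by rewrite lerBlDl; apply: ge_inf => //; apply: SD.
apply/eqP; rewrite eq_le leZ //= -ler_pdivlMl //.
by rewrite -[X in inf (S X) <= _](scalerK (lt0r_neq0 a0)) leZ ?invr_gt0.
Qed.

(** One step of Hahn-Banach: [q x] is the infimum over [t >= 0] of [p (x + t v) - t p v], bounded
    below by [- p (- x)]. Taking [t = 0] gives [q <= p], and [t = 1] at [- v] gives the last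
    bound. *)
Lemma sublinear_tilt p v : sublinear p ->
  exists q, [/\ sublinear q, forall x, q x <= p x & q (- v) <= - p v].
Proof.
move=> sp; have [pD pZ] := sp.
pose S x := [set r | exists2 t, 0 <= t & p (x + t *: v) - t * p v <= r].
have tp t : 0 <= t -> t * p v = p (t *: v).
  by rewrite le_eqVlt => /predU1P[<-|/pZ-> //]; rewrite mul0r scale0r sublinear0.
have Sb x : has_lbound (S x).
  exists (- p (- x)) => r [t /= t0]; apply: le_trans.
  rewrite lerBrDr addrC lerBlDr tp //.
  by apply: le_trans (pD _ _); rewrite addrAC subrr add0r.
exists (fun x => inf (S x)); split.
- apply: inf_sublinear => //.
  + by move=> x; exists (p x), 0 => //; rewrite scale0r mul0r addr0 subr0.
  + move=> x y t u [a /= a0 le1] [b /= b0 le2]; exists (a + b); first exact: addr_ge0.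
    apply: le_trans (lerD le1 le2); rewrite scalerDl addrACA mulrDl opprD [leRHS]addrACA.
    by rewrite lerD2r.
  + move=> a x t a0 [u /= u0 le1]; exists (a * u); first by rewrite /= mulr_ge0 // ltW.
    by rewrite -scalerA -scalerDr pZ // -mulrA -mulrBr ler_pM2l.
- move=> x; apply: ge_inf => //; exists 0 => //=.
  by rewrite scale0r mul0r addr0 subr0.
- apply: ge_inf => //; exists 1 => //=.
  by rewrite scale1r addNr sublinear0 // mul1r sub0r.
Qed.

(** One tilt per vector of the list. Oddness gained earlier survives, since decreasing [q] lowers
    [q (- v)] and raises [- q v]. *)
Lemma sublinear_odd_on p (s : seq V) : sublinear p ->
  exists q, [/\ sublinear q, forall x, q x <= p x &
                 forall v, v \in s -> q (- v) <= - q v].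
Proof.
move=> sp; elim: s => [|v s [q [sq qp qs]]]; first by exists p.
have [q' [sq' q'q q'v]] := sublinear_tilt v sq.
exists q'; split=> // [x|w]; first exact: le_trans (qp x).
rewrite inE => /predU1P[->|ws]; first by apply: le_trans q'v _; rewrite lerN2.
by apply: le_trans (q'q _) _; apply: le_trans (qs _ ws) _; rewrite lerN2.
Qed.

Lemma sublinear_oddD q v w : sublinear q -> q (- v) <= - q v -> q (- w) <= - q w ->
  q (- (v + w)) <= - q (v + w).
Proof.
move=> sq ov ow; rewrite opprD; apply: le_trans (sq.1 _ _) _.
by apply: le_trans (lerD ov ow) _; rewrite -opprD lerN2 sq.1.
Qed.

Lemma sublinear_oddZ q a v : sublinear q -> q (- v) <= - q v ->
  q (- (a *: v)) <= - q (a *: v).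
Proof.
move=> sq ov; have [qD qZ] := sq; case: (ltgtP a 0) => [a0|a0|->].
- have a0' : 0 < - a by rewrite oppr_gt0.
  rewrite -scaleNr qZ // -[in leRHS](opprK a) scaleNr -scalerN qZ //.
  by rewrite -mulrN ler_pM2l // lerNr.
- by rewrite -scalerN !qZ // -mulrN ler_pM2l.
- by rewrite scale0r oppr0 sublinear0 // oppr0.
Qed.

(** Oddness turns subadditivity at the opposite vectors into superadditivity. *)
Lemma sublinear_odd_linear q : sublinear q -> (forall v, q (- v) <= - q v) ->
  (forall x y, q (x + y) = q x + q y) /\ (forall a x, q (a *: x) = a * q x).
Proof.
move=> sq od; have [qD qZ] := sq.
have qN x : q (- x) = - q x by apply/eqP; rewrite eq_le od sublinearN.
split=> [x y|a x].
  apply/eqP; rewrite eq_le qD /= -lerN2 -qN !opprD -!qN; exact: qD.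
case: (ltgtP a 0) => [a0|a0|->]; last by rewrite scale0r mul0r sublinear0.
  by rewrite -[a]opprK scaleNr qN qZ ?oppr_gt0 // [RHS]mulNr.
exact: qZ.
Qed.
End Sublinear.

Section ConeAlternative.
Local Open Scope classical_set_scope.
Variables (R : realType) (N : nat).
Implicit Types (c Y Z : 'M[R]_N) (z : 'cV[R]_N).

Definition qform Y z : R := (z^T *m Y *m z) 0 0.

Lemma qformE Y z : qform Y z = \sum_i \sum_j z i 0 * Y i j * z j 0.
Proof.
rewrite /qform mxE exchange_big; apply: eq_bigr => j _ /=.
by rewrite mxE mulr_suml; apply: eq_bigr => i _; rewrite mxE.
Qed.

Lemma qformD Y Y' z : qform (Y + Y') z = qform Y z + qform Y' z.
Proof. by rewrite /qform mulmxDr mulmxDl mxE. Qed.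

Lemma qformZ a Y z : qform (a *: Y) z = a * qform Y z.
Proof. by rewrite /qform -scalemxAr -scalemxAl mxE. Qed.

Lemma qformN Y z : qform (- Y) z = - qform Y z.
Proof. by rewrite -scaleN1r qformZ mulN1r. Qed.

Lemma qform_tr Y z : qform Y^T z = qform Y z.
Proof.
have e : z^T *m Y^T *m z = (z^T *m Y *m z)^T by rewrite !trmx_mul trmxK mulmxA.
by rewrite /qform e mxE.
Qed.

Lemma qform1E z : qform 1%:M z = \sum_i z i 0 ^+ 2.
Proof. by rewrite /qform mulmx1 mxE; apply: eq_bigr => i _; rewrite mxE. Qed.

Lemma qform_bound Y : exists2 k, 0 <= k & forall z, qform Y z <= k * qform 1%:M z.
Proof.
exists (\sum_i \sum_j `|Y i j|) => [|z].
  by apply: sumr_ge0 => i _; apply: sumr_ge0.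
rewrite qformE mulr_suml; apply: ler_sum => i _.
rewrite mulr_suml; apply: ler_sum => j _.
have le1 k : z k 0 ^+ 2 <= qform 1%:M z.
  by rewrite qform1E (bigD1 k) //= lerDl; apply: sumr_ge0 => l _; apply: sqr_ge0.
apply: le_trans (ler_norm _) _; rewrite !normrM mulrAC [leLHS]mulrC.
apply: ler_wpM2l => //.
have := le1 i; have := le1 j; rewrite -(real_normK (num_real (z i 0))).
rewrite -(real_normK (num_real (z j 0))).
have := sqr_ge0 (`|z j 0| - `|z i 0|); nra.
Qed.

(* The infimum of the [t] such that [Y + c <= t] for some [c] in the cone is
   sublinear; a linear form below it is nonnegative on the cone and on the
   positive semidefinite matrices. *)
Theorem cone_alternative (K : 'M[R]_N -> Prop) :
    K 0 -> (forall c d, K c -> K d -> K (c + d)) ->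
    (forall a c, 0 < a -> K c -> K (a *: c)) ->
    (forall c t, K c -> (forall z, qform c z <= t * qform 1%:M z) -> 0 <= t) ->
  exists Z, [/\ possemidefmx Z, Z != 0 & forall c, K c -> 0 <= \tr (Z *m c)].
Proof.
move=> K0 KD KZ Kneg.
pose S Y := [set t | exists2 c, K c & forall z, qform (Y + c) z <= t * qform 1%:M z].
have hS Y : has_lbound (S Y).
  have [k _ Hk] := qform_bound (- Y); exists (- k) => t [c Kc Hc].
  rewrite lerNl -subr_ge0 opprK addrC; apply: (Kneg c) => // z.
  by rewrite mulrDl -[c](addKr Y) qformD addrC; apply: lerD.
have sp : sublinear (fun Y => inf (S Y)).
  apply: inf_sublinear => // [Y|Y Y' t u [c Kc Hc] [d Kd Hd]|a Y t a0 [c Kc Hc]].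
  - have [k _ Hk] := qform_bound Y; exists k, 0 => //= z; rewrite addr0; exact: Hk.
  - exists (c + d); first exact: KD.
    by move=> z; rewrite addrACA qformD mulrDl; apply: lerD.
  - exists (a *: c); first exact: KZ.
    by move=> z; rewrite -scalerDr qformZ -mulrA ler_pM2l.
(* The matrix units span the space, so oddness on them spreads to all matrices and makes [q]
   linear. *)
have [q [sq qp qo]] := sublinear_odd_on [seq delta_mx i.1 i.2 | i <- enum {: 'I_N * 'I_N}] sp.
have qS Y t c : K c -> (forall z, qform (Y + c) z <= t * qform 1%:M z) -> q Y <= t.
  by move=> Kc Hc; apply: le_trans (qp Y) _; apply: ge_inf => //; exists c.
have odd Y : q (- Y) <= - q Y.
  rewrite [Y]matrix_sum_delta pair_big /=.
  elim/big_rec: _ => [|i x _ ox]; first by rewrite oppr0 sublinear0 // oppr0.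
  apply: sublinear_oddD => //; apply: sublinear_oddZ => //; apply: qo.
  by apply/mapP; exists i => //; rewrite mem_enum.
have [qD qZ] := sublinear_odd_linear sq odd.
pose Z := \matrix_(j, i) q (delta_mx i j).
have qE Y : q Y = \tr (Z *m Y).
  have qsum (I : finType) (F : I -> 'M_N) : q (\sum_i F i) = \sum_i q (F i).
    by apply: (big_morph q) => //; exact: sublinear0.
  rewrite {1}[Y]matrix_sum_delta qsum.
  under eq_bigr do rewrite qsum; rewrite exchange_big /mxtrace.
  by apply: eq_bigr => j _; rewrite mxE; apply: eq_bigr => i _; rewrite qZ mxE mulrC.
have qN Y : q (- Y) = - q Y by rewrite -scaleN1r qZ mulN1r.
have le0 Y c : K c -> (forall z, qform (Y + c) z <= 0) -> q Y <= 0.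
  by move=> Kc Hc; apply: (qS Y 0 c Kc) => z; rewrite mul0r.
exists Z; split.
- split.
    apply/matrixP => i j; rewrite !mxE.
    (* The difference of two transposed matrix units has zero quadratic form, so [q] is at most 0 on
       it; exchanging the indices gives equality. *)
    have h k l : q (delta_mx k l) <= q (delta_mx l k).
      rewrite -subr_le0 -qN -qD; apply: (le0 _ 0 K0) => z.
      by rewrite addr0 -trmx_delta qformD qformN qform_tr subrr.
    by apply/eqP; rewrite eq_le !h.
  (* [q] is tested on [- z z^T], which is negative semidefinite. *)
  move=> z; rewrite -oppr_le0 (_ : (z^T *m Z *m z) 0 0 = \tr (Z *m (z *m z^T))).
    rewrite -qE -qN; apply: (le0 _ 0 K0) => y.
    rewrite addr0 qformN oppr_le0 /qform mulmxA -mulmxA mxE big_ord1.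
    have -> : z^T *m y = (y^T *m z)^T by rewrite trmx_mul trmxK.
    by rewrite [X in _ * X]mxE -expr2 sqr_ge0.
  by rewrite mulmxA mxtrace_mulC mulmxA trace_mx11.
- apply/eqP => Z0; have := qE 1%:M.
  have : q (- 1%:M) <= - 1.
    by apply: (qS _ _ 0 K0) => z; rewrite addr0 qformN mulN1r.
  by rewrite qN => + e; rewrite e Z0 mul0mx mxtrace0 oppr0 oppr_ge0 ler10.
(* Adding the cone element [c] to [- c] leaves 0, whence [q (- c) <= 0]. *)
- move=> c Kc; rewrite -qE -oppr_le0 -qN; apply: (le0 _ c Kc) => z.
  by rewrite addNr /qform mulmx0 mul0mx mxE.
Qed.
End ConeAlternative.

(** * Hermitian forms and skew pairs *)

Section Adjoint.
Variable C : numClosedFieldType.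

Lemma adjmxD m n (A B : 'M[C]_(m, n)) : (A + B) ^t* = A ^t* + B ^t*.
Proof. by rewrite linearD /= map_mxD. Qed.

Lemma adjmxN m n (A : 'M[C]_(m, n)) : (- A) ^t* = - A ^t*.
Proof. by rewrite linearN /= map_mxN. Qed.

Lemma adjmxB m n (A B : 'M[C]_(m, n)) : (A - B) ^t* = A ^t* - B ^t*.
Proof. by rewrite adjmxD adjmxN. Qed.

Lemma adjmxM m n p (A : 'M[C]_(m, n)) (B : 'M[C]_(n, p)) :
  (A *m B) ^t* = B ^t* *m A ^t*.
Proof. by rewrite trmx_mul map_mxM. Qed.

Lemma adjmxZ m n a (A : 'M[C]_(m, n)) : (a *: A) ^t* = a^* *: A ^t*.
Proof. by rewrite linearZ /= map_mxZ. Qed.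

Lemma adjmx0 m n : (0 : 'M[C]_(m, n)) ^t* = 0.
Proof. by rewrite trmx0 map_mx0. Qed.

Lemma adjmx1 n : (1%:M : 'M[C]_n) ^t* = 1%:M.
Proof. by rewrite trmx1 map_mx1. Qed.

Lemma adj_mulmx_ge0 n (x : 'cV[C]_n) : 0 <= (x ^t* *m x) 0 0.
Proof.
rewrite mxE; apply: sumr_ge0 => i _; rewrite !mxE mulrC; exact: mul_conjC_ge0.
Qed.

Lemma adj_mulmx_eq0 n (x : 'cV[C]_n) : (x ^t* *m x) 0 0 = 0 -> x = 0.
Proof.
rewrite mxE => /eqP; rewrite psumr_eq0 => [/allP x0|i _]; last first.
  by rewrite !mxE mulrC mul_conjC_ge0.
apply/colP => i; have := x0 i (mem_index_enum _).
by rewrite !mxE mulrC mul_conjC_eq0 => /eqP.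
Qed.

(** The orthogonal projector onto the row space of [G] has its rows in that space, so it factors as
    [Gp G]. *)
Lemma row_space_projector n k (G : 'M[C]_(n, k)) :
  exists Gp : 'M_(k, n), G *m Gp *m G = G /\ (Gp *m G) ^t* = Gp *m G.
Proof.
have /submxP[Gp PiE] := proj_ortho_sub G 1%:M; rewrite mul1mx in PiE.
have /orthomx1P := proj_ortho_compl_sub G 1%:M; rewrite mul1mx PiE => ort.
have herm : (Gp *m G) ^t* = Gp *m G.
  have e : (Gp *m G) ^t* = (Gp *m G) *m (Gp *m G) ^t*.
    apply/eqP; rewrite -subr_eq0 -[X in X - _]mul1mx -mulmxBl adjmxM mulmxA ort.
    by rewrite mul0mx.
  by rewrite -[RHS]trmxCK [in RHS]e [RHS]adjmxM trmxCK -e.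
exists Gp; split=> //; apply/eqP; rewrite -subr_eq0 -[X in _ - X]mulmx1 -mulmxA -mulmxBr.
by rewrite -[_ *m _]trmxCK adjmxM adjmxB adjmx1 herm -opprB mulNmx ort oppr0 adjmx0.
Qed.

Lemma skew_scalar (x : C) : x^* = - x -> 0 <= x -> x = 0.
Proof.
move=> sk /ger0_real /CrealP; rewrite sk => /eqP.
by rewrite eq_sym -addr_eq0 -mulr2n mulrn_eq0 => /eqP.
Qed.

Lemma adj_scalar11 (M : 'M[C]_1) : (M ^t*) 0 0 = (M 0 0)^*.
Proof. by rewrite !mxE. Qed.

Lemma adj_form n (M : 'M[C]_n) (x y : 'cV[C]_n) :
  ((x ^t* *m M *m y) 0 0)^* = (y ^t* *m M ^t* *m x) 0 0.
Proof. by rewrite -adj_scalar11 !adjmxM trmxCK mulmxA. Qed.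

(* [S := G^+ F] compressed to the row space of [G] is skew-Hermitian and
   intertwines [F] and [G]; completing it by the identity on the kernel of [G]
   gives a normal matrix, and the basis is a unitary eigenbasis of it. *)
Theorem skew_pair_eigenbasis n k (F G : 'M[C]_(n, k)) :
    F *m G ^t* + G *m F ^t* = 0 ->
  exists2 V : 'M[C]_k, V *m V ^t* = 1%:M &
    forall i, G *m col i V = 0 \/
      exists2 a : C, a^* = - a & F *m col i V = a *: (G *m col i V).
Proof.
move=> FG; have [Gp [GGpG herm]] := row_space_projector G.
set Pi := Gp *m G in herm.
have GPi : G *m Pi = G by rewrite mulmxA.
have PiPi : Pi *m Pi = Pi by rewrite {1}/Pi -mulmxA GPi.
have PiE : Pi = G ^t* *m Gp ^t* by rewrite -herm adjmxM.
have FGE : F *m G ^t* = - (G *m F ^t*) by apply/eqP; rewrite -addr_eq0 FG.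
pose S := Gp *m F *m Pi.
have SE : S = - (Pi *m F ^t* *m Gp ^t*).
  by rewrite /S [in LHS]PiE mulmxA -(mulmxA Gp) FGE mulmxN mulNmx !mulmxA.
clearbody Pi.
have skew : S ^t* = - S.
  by rewrite [in RHS]SE opprK /S !adjmxM herm mulmxA.
have GS : G *m S = F *m Pi.
  by rewrite SE mulmxN !mulmxA GPi -mulNmx -FGE -mulmxA -PiE.
have SPi : S *m Pi = S by rewrite /S -mulmxA PiPi.
have PiS : Pi *m S = S by rewrite SE mulmxN !mulmxA PiPi.
pose T := S + (1%:M - Pi).
have QS : (1%:M - Pi) *m S = 0 by rewrite mulmxBl mul1mx PiS subrr.
have SQ : S *m (1%:M - Pi) = 0 by rewrite mulmxBr mulmx1 SPi subrr.
have PiQ : Pi *m (1%:M - Pi) = 0 by rewrite mulmxBr mulmx1 PiPi subrr.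
have QQ : (1%:M - Pi) *m (1%:M - Pi) = 1%:M - Pi.
  by rewrite [LHS]mulmxBl mul1mx PiQ subr0.
have normT : T \is normalmx.
  apply/normalmxP; rewrite /T adjmxD skew adjmxB adjmx1 herm.
  move: QS SQ QQ; move: (1%:M - Pi) => Q QS SQ QQ.
  by rewrite !mulmxDl !mulmxDr !mulmxN !mulNmx SQ QS oppr0 QQ.
have Pu := spectral_unitarymx T; have /orthomx_spectralP := normT.
set P := spectralmx T in Pu *; set d := spectral_diag T => TE.
have TP : T *m P ^t* = P ^t* *m diag_mx d.
  by rewrite {1}TE (mulmxtVK _ Pu) invmx_unitary.
exists (P ^t*).
  by rewrite trmxCK; apply: mulmx1C; apply/unitarymxP.
move=> i; set v := col i _.
have Tv : T *m v = d 0 i *: v.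
  rewrite /v !colE mulmxA TP -mulmxA scalemxAr; congr (_ *m _).
  rewrite mul_diag_mx; apply/colP => j; rewrite !mxE andbT.
  by case: eqVneq => [->|]; rewrite ?mulr1 ?mulr0.
have Sv : S *m v = d 0 i *: (Pi *m v).
  by rewrite scalemxAr -Tv mulmxA mulmxDr PiS PiQ addr0.
have Qv : (1%:M - Pi) *m v = d 0 i *: ((1%:M - Pi) *m v).
  by rewrite [in RHS]scalemxAr -Tv [RHS]mulmxA mulmxDr QS QQ add0r.
pose s := (v ^t* *m S *m v) 0 0; pose q := (v ^t* *m Pi *m v) 0 0.
have q0 : 0 <= q.
  by rewrite /q -PiPi -[X in X *m Pi]herm mulmxA -mulmxA -adjmxM adj_mulmx_ge0.
have sE : s = d 0 i * q by rewrite /s -mulmxA Sv -scalemxAr mxE mulmxA.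
have sskew : s^* = - s.
  by rewrite /s adj_form skew mulmxN mulNmx mxE.
(* For eigenvalue 1, [q = s] is skew and nonnegative, hence zero, so [G v = 0]. Any other eigenvalue
   forces [(1 - Pi) v = 0]; then [q = 1], and the eigenvalue, equal to [s], is skew. *)
case: (eqVneq (d 0 i) 1) => d1.
  left; have : q = 0.
    by apply: skew_scalar q0; move: sskew; rewrite sE d1 mul1r.
  rewrite /q -PiPi -[X in X *m Pi]herm mulmxA -mulmxA -adjmxM => /adj_mulmx_eq0 e.
  by rewrite -GPi -mulmxA e mulmx0.
have vPi : Pi *m v = v.
  apply/eqP; rewrite eq_sym -subr_eq0 -[X in X - _]mul1mx -mulmxBl.
  move/eqP: Qv; rewrite -subr_eq0 -[X in X - _]scale1r -scalerBl scaler_eq0.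
  by rewrite subr_eq0 eq_sym (negPf d1).
right; exists (d 0 i); last by rewrite -{1}vPi mulmxA -GS -mulmxA Sv vPi -scalemxAr.
have q1 : q = 1.
  rewrite /q -mulmxA vPi /v !colE adjmxM trmxCK -mulmxA (mulmxA P).
  rewrite (unitarymxP Pu) mul1mx trmx_delta map_delta_mx mul_delta_mx.
  by rewrite mxE !eqxx.
by move: sskew; rewrite sE q1 mulr1.
Qed.

Lemma psd_factor n (H : 'M[C]_n) : H ^t* = H ->
  (forall x : 'cV_n, 0 <= (x ^t* *m H *m x) 0 0) -> exists W : 'M_n, H = W *m W ^t*.
Proof.
move=> Hh Hp; have Hn : H \is normalmx by apply/normalmxP; rewrite Hh.
have Pu := spectral_unitarymx H; have /orthomx_spectralP := Hn.
set P := spectralmx H in Pu *; set d := spectral_diag H; rewrite invmx_unitary // => HE.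
have d_ge0 i : 0 <= d 0 i.
  pose v : 'cV_n := P ^t* *m delta_mx i 0.
  suff -> : d 0 i = (v ^t* *m H *m v) 0 0 by exact: Hp.
  rewrite /v HE adjmxM trmxCK !mulmxA !(mulmxtVK _ Pu) trmx_delta map_delta_mx.
  by rewrite -rowE -colE !mxE eqxx.
exists (P ^t* *m diag_mx (map_mx sqrtC d)).
rewrite adjmxM trmxCK tr_diag_mx map_diag_mx mulmxA -(mulmxA (P ^t*)) mulmx_diag HE.
congr (_ *m diag_mx _ *m _); apply/rowP => i; rewrite !mxE.
by rewrite -normCK ger0_norm ?sqrtC_ge0 // sqrtCK.
Qed.

(** The first basis vector [e] is an eigenvector of [T], and the inequality at [e] makes
    [xi = e^* X e] positive. On the [X]-orthogonal complement of [e], [T] acts modulo [e] as its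
    trailing block, which inherits the inequality. *)
Lemma lyapunov_triangular k (T X : 'M[C]_k) :
    (forall i j : 'I_k, (j < i)%N -> T i j = 0) ->
    (forall i, T i i + (T i i)^* < 0) -> X ^t* = X ->
    (forall x : 'cV_k, x != 0 -> (x ^t* *m (T ^t* *m X + X *m T) *m x) 0 0 < 0) ->
  forall x : 'cV_k, 0 <= (x ^t* *m X *m x) 0 0.
Proof.
elim: k T X => [|k IH] T X Ttrig Tneg Xh Lneg x.
  by rewrite [x]flatmx0 mulmx0 mxE.
move: T X Ttrig Tneg Xh Lneg x; rewrite -[k.+1]/(1 + k)%N => T X Ttrig Tneg Xh Lneg x.
pose e : 'cV[C]_(1 + k) := col_mx 1%:M 0.
pose l : C := ulsubmx T 0 0; pose t := ursubmx T; pose T' := drsubmx T.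
have TE : T = block_mx l%:M t 0 T'.
  rewrite -[LHS]submxK /l -mx11_scalar; congr block_mx.
  by apply/matrixP => i j; rewrite !mxE Ttrig //= !ord1.
have Te : T *m e = l *: e.
  rewrite TE /e mul_block_col !mulmx0 !addr0 !mul0mx mulmx1 scale_col_mx scaler0.
  by rewrite scalemx1.
pose xi : C := (e ^t* *m X *m e) 0 0.
have xi_gt0 : 0 < xi.
  have : (e ^t* *m (T ^t* *m X + X *m T) *m e) 0 0 < 0.
    apply: Lneg; apply/eqP => /matrixP/(_ (lshift _ 0) 0).
    by rewrite col_mxEu !mxE; apply/eqP; rewrite oner_eq0.
  rewrite mulmxDr mulmxDl mxE !mulmxA -adjmxM -(mulmxA _ T e) Te adjmxZ.
  rewrite -!scalemxAl -scalemxAr mxE [X in _ + X]mxE -/xi -mulrDl nmulr_rlt0 //.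
  by rewrite addrC /l !mxE.
have xiR : xi^* = xi by rewrite /xi adj_form Xh.
have cE : X *m e = col_mx xi%:M (dsubmx (X *m e)).
  rewrite -[LHS]vsubmxK; congr col_mx; rewrite [LHS]mx11_scalar; congr (_%:M).
  rewrite /xi -mulmxA -{2}[X *m e]vsubmxK /e tr_col_mx map_row_mx mul_row_col.
  by rewrite trmx0 map_mx0 mul0mx addr0 adjmx1 mul1mx.
set b := dsubmx _ in cE.
(* [w] solves [xi w + b^* = 0], which makes the columns of [L] orthogonal to [e] for [X]. *)
pose w : 'M_(1, k) := - (xi^-1 *: b ^t*); pose L := col_mx w 1%:M.
have LXe : L ^t* *m X *m e = 0.
  rewrite -mulmxA cE /L tr_col_mx map_row_mx mul_row_col adjmx1 mul1mx.
  rewrite /w adjmxN adjmxZ trmxCK mul_mx_scalar fmorphV /= xiR scalerN scalerA.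
  by rewrite mulfV ?gt_eqF // scale1r addNr.
have eXL : e ^t* *m X *m L = 0.
  have /(congr1 (fun M => M ^t*)) := LXe.
  by rewrite adjmxM adjmxM trmxCK Xh mulmxA adjmx0.
pose r := l *: w + t - w *m T'.
have TL : T *m L = L *m T' + e *m r.
  rewrite TE /L /e mul_block_col mul_col_mx !mul0mx !mul1mx !mulmx1 mul_col_mx mul0mx.
  rewrite mul1mx add_col_mx addr0 add0r mul_scalar_mx /r.
  by rewrite [w *m T' + _]addrC subrK.
pose X' := L ^t* *m X *m L.
have X'h : X' ^t* = X' by rewrite /X' !adjmxM trmxCK Xh mulmxA.
(* The terms containing [e r] vanish by the orthogonality of [e] and [L] for [X]. *)
have key : L ^t* *m (T ^t* *m X + X *m T) *m L = T' ^t* *m X' + X' *m T'.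
  rewrite mulmxDr mulmxDl !mulmxA -adjmxM TL -(mulmxA _ T L) TL adjmxD !adjmxM.
  rewrite !mulmxDl mulmxDr !mulmxA LXe mul0mx addr0.
  by rewrite -!(mulmxA (r ^t*)) eXL mulmx0 addr0.
have X'_ge0 : forall y : 'cV_k, 0 <= (y ^t* *m X' *m y) 0 0.
  apply: (IH T') => // [i j ji|i|y y0].
  - by rewrite /T' !mxE Ttrig.
  - by have := Tneg (rshift 1 i); rewrite /T' !mxE.
  rewrite -key !mulmxA -adjmxM -mulmxA; apply: Lneg.
  apply: contra y0 => /eqP; rewrite /L mul_col_mx mul1mx => Ly0.
  by rewrite -[y](col_mxKd (w *m y)) Ly0 linear0.
pose y := dsubmx x; pose a : C := usubmx x 0 0 - (w *m y) 0 0.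
have xE : x = a *: e + L *m y.
  rewrite /e /L scale_col_mx mul_col_mx mul1mx scaler0 add_col_mx add0r scalemx1.
  rewrite -[LHS]vsubmxK; congr col_mx; rewrite [LHS]mx11_scalar [w *m y]mx11_scalar.
  by rewrite -raddfD /= subrK.
have -> : (x ^t* *m X *m x) 0 0 = a * a^* * xi + (y ^t* *m X' *m y) 0 0.
  rewrite xE adjmxD adjmxZ adjmxM !mulmxDl !mulmxDr -!scalemxAl -!scalemxAr.
  rewrite !mulmxA eXL mul0mx scaler0 -!(mulmxA (y ^t*)) LXe mulmx0 scaler0 add0r.
  by rewrite addr0 scalerA mxE [X in X + _]mxE -/xi [a^* * a]mulrC.
by rewrite addr_ge0 // mulr_ge0 ?mul_conjC_ge0 // ltW.
Qed.
End Adjoint.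

(** * Evaluation of the transfer function *)

Section RationalEvaluation.
Local Open Scope quotient_scope.
Variable F : fieldType.
Implicit Types (f : {fraction {poly F}}) (p q : {poly F}) (s : F).

Lemma frac_reprE f :
  f = FracField.tofrac (repr f).1 / FracField.tofrac (repr f).2.
Proof.
rewrite -[LHS]reprK; set x := repr f; have d0 : x.2 != 0 by apply: denom_ratioP.
rewrite -[GRing.inv _]/(FracField.inv _) -[GRing.mul _ _]/(FracField.mul _ _).
rewrite !piE /FracField.mulf /FracField.invf !numden_Ratio ?oner_neq0 //.
by rewrite mulr1 mul1r Ratio_numden.
Qed.

(** The reduced denominator, coprime to the reduced numerator, divides every denominator of the same
    fraction, [q] included; so it is nonzero wherever [q] is. *)
Lemma rat_eval_frac p q s : q.[s] != 0 ->
  let f := FracField.tofrac p / FracField.tofrac q in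
  ~ is_pole f s /\ rat_eval f s = p.[s] / q.[s].
Proof.
move=> qs f; have q0 : q != 0 by apply: contraNneq qs => ->; rewrite horner0.
have d0 : (repr f).2 != 0 by apply: denom_ratioP.
set a := (repr f).1; set b := (repr f).2 in d0 *.
have g0 : frac_gcd f != 0 by rewrite gcdp_eq0 negb_and d0 orbT.
have aE : a = rat_num f * frac_gcd f by rewrite divpK // dvdp_gcdl.
have bE : b = rat_den f * frac_gcd f by rewrite divpK // dvdp_gcdr.
have cop : coprimep (rat_den f) (rat_num f).
  rewrite coprimep_sym; apply: coprimep_div_gcd.
  by rewrite d0 orbT.
have cross : rat_num f * q = rat_den f * p.
  apply: (mulIf g0); rewrite mulrAC -aE [RHS]mulrAC -bE.
  move: (frac_reprE f); rewrite -/a -/b {1}/f => /eqP.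
  by rewrite eqr_div ?tofrac_eq0 // -!tofracM tofrac_eq mulrC => /eqP <-; rewrite mulrC.
have dvd : rat_den f %| q.
  by rewrite -(Gauss_dvdpr _ cop) cross dvdp_mulr.
have np : ~~ root (rat_den f) s.
  apply: contra qs => rd; have /dvdpP[u ->] := dvd.
  by rewrite hornerM (rootP rd) mulr0.
split; first exact/negP.
apply/eqP; rewrite eqr_div //; apply/eqP.
by rewrite -!hornerM cross mulrC.
Qed.
End RationalEvaluation.

Section Transfer.
Variables (R : realType) (n m : nat).
Variables (E A : 'M[R]_n) (B : 'M[R]_(n, m)) (C : 'M[R]_(m, n)) (D : 'M[R]_m).
Local Notation K := R[i].
Local Notation cE := (complexmx E).
Local Notation cA := (complexmx A).

Lemma pencil_horner s : map_mx (horner_eval s) (pencil E A) = s *: cE - cA.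
Proof.
by apply/matrixP => i j; rewrite !mxE /horner_eval !hornerE.
Qed.

Lemma det_pencil_horner s : (\det (pencil E A)).[s] = \det (s *: cE - cA).
Proof.
by rewrite -pencil_horner -[LHS]/(horner_eval s _) -det_map_mx.
Qed.

(** Cramer's rule puts all entries over the common denominator [det (zE - A)] with polynomial
    numerators, so evaluation commutes with the formula where that determinant is nonzero. *)
Lemma transfer_at_resolvent s : \det (s *: cE - cA) != 0 ->
  ~ transfer_pole E A B C D s /\
  transfer_at E A B C D s =
    complexmx C *m invmx (s *: cE - cA) *m complexmx B + complexmx D.
Proof.
move=> ds; pose d := \det (pencil E A).
have ds' : d.[s] != 0 by rewrite det_pencil_horner.
have d0 : d != 0 by apply: contraNneq ds' => ->; rewrite horner0.
pose Cp : 'M[{poly K}]_(m, n) := map_mx polyC (complexmx C).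
pose Bp : 'M[{poly K}]_(n, m) := map_mx polyC (complexmx B).
pose Dp : 'M[{poly K}]_m := map_mx polyC (complexmx D).
pose P := Cp *m \adj (pencil E A) *m Bp + d *: Dp.
have trE : transfer E A B C D = (FracField.tofrac d)^-1 *: map_mx (@FracField.tofrac _) P.
  have ratE p q (M : 'M[R]_(p, q)) :
    ratmx M = map_mx (@FracField.tofrac _) (map_mx polyC (complexmx M)).
    by apply/matrixP => i j; rewrite !mxE.
  have td0 : FracField.tofrac d != 0 by rewrite tofrac_eq0.
  have -> : transfer E A B C D = ratmx C *m
      invmx (map_mx (@FracField.tofrac _) (pencil E A)) *m ratmx B + ratmx D by [].
  rewrite /invmx unitmxE det_map_mx unitfE td0 -map_mx_adj !ratE /P map_mxD map_mxZ.
  by rewrite !map_mxM scalerDr scalerA mulVf // scale1r -scalemxAr -scalemxAl.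
have PE : map_mx (horner_eval s) P =
    complexmx C *m \adj (s *: cE - cA) *m complexmx B + d.[s] *: complexmx D.
  have cE p q (M : 'M[K]_(p, q)) : map_mx (horner_eval s) (map_mx polyC M) = M.
    by apply/matrixP => i j; rewrite !mxE /horner_eval hornerC.
  by rewrite /P map_mxD map_mxZ !map_mxM map_mx_adj pencil_horner !cE.
have su : s *: cE - cA \in unitmx by rewrite unitmxE unitfE.
have trEij i j : transfer E A B C D i j = FracField.tofrac (P i j) / FracField.tofrac d.
  by rewrite trE !mxE mulrC.
split=> [[i [j]]|].
  by rewrite trEij; case: (rat_eval_frac (P i j) ds').
apply/matrixP => i j; rewrite [LHS]mxE trEij; case: (rat_eval_frac (P i j) ds') => _ ->.
have -> : (P i j).[s] = (map_mx (horner_eval s) P) i j by rewrite [RHS]mxE.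
rewrite PE /invmx su -det_pencil_horner -/d -scalemxAr -scalemxAl.
move: (_ *m _ *m _) => X; rewrite !mxE mulrDl mulrC [X in _ + X]mulrC mulrA mulVf //.
by rewrite mul1r.
Qed.
End Transfer.

(** * Pairs of index at most one *)

(* Instances at [R[i]]: used directly, the general statements produce ring
   structures that are only convertible to those of matrices over [R[i]], on
   which rewriting is prohibitively slow. *)
Section ComplexAdjoint.
Variable R : realType.
Local Notation K := R[i].

Lemma cadjD m n (A B : 'M[K]_(m, n)) : (A + B) ^t* = A ^t* + B ^t*.
Proof. exact: adjmxD. Qed.

Lemma cadjN m n (A : 'M[K]_(m, n)) : (- A) ^t* = - A ^t*.
Proof. exact: adjmxN. Qed.

Lemma cadjM m n p (A : 'M[K]_(m, n)) (B : 'M[K]_(n, p)) :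
  (A *m B) ^t* = B ^t* *m A ^t*.
Proof. exact: adjmxM. Qed.

Lemma cadjZ m n a (A : 'M[K]_(m, n)) : (a *: A) ^t* = a^* *: A ^t*.
Proof. exact: adjmxZ. Qed.

Lemma cadj0 m n : (0 : 'M[K]_(m, n)) ^t* = 0.
Proof. exact: adjmx0. Qed.

Lemma cadj1 n : (1%:M : 'M[K]_n) ^t* = 1%:M.
Proof. exact: adjmx1. Qed.

Lemma cadjK m n (A : 'M[K]_(m, n)) : A ^t* ^t* = A.
Proof. exact: trmxCK. Qed.

Lemma cadj_col_mx m n p (A : 'M[K]_(m, p)) (B : 'M_(n, p)) :
  (col_mx A B) ^t* = row_mx (A ^t*) (B ^t*).
Proof. by rewrite tr_col_mx map_row_mx. Qed.

Lemma cadj_block_mx m1 m2 n1 n2 (A : 'M[K]_(m1, n1)) (B : 'M_(m1, n2))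
    (C : 'M_(m2, n1)) (D : 'M_(m2, n2)) :
  (block_mx A B C D) ^t* = block_mx (A ^t*) (C ^t*) (B ^t*) (D ^t*).
Proof. by rewrite tr_block_mx map_block_mx. Qed.

Lemma cadj_congr n p k (M : 'M[K]_n) (T : 'M[K]_(n, p)) (x y : 'M[K]_(p, k)) :
  x ^t* *m (T ^t* *m M *m T) *m y = (T *m x) ^t* *m M *m (T *m y).
Proof. by rewrite cadjM !mulmxA. Qed.

Lemma cskew_pair_eigenbasis n k (F G : 'M[K]_(n, k)) :
    F *m G ^t* + G *m F ^t* = 0 ->
  exists2 V : 'M[K]_k, V *m V ^t* = 1%:M &
    forall i, G *m col i V = 0 \/
      exists2 a : K, a^* = - a & F *m col i V = a *: (G *m col i V).
Proof. exact: skew_pair_eigenbasis. Qed.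

Lemma crow_space_projector n k (G : 'M[K]_(n, k)) :
  exists Gp : 'M_(k, n), G *m Gp *m G = G /\ (Gp *m G) ^t* = Gp *m G.
Proof. exact: row_space_projector. Qed.

Lemma cpsd_factor n (H : 'M[K]_n) : H ^t* = H ->
  (forall x : 'cV_n, 0 <= (x ^t* *m H *m x) 0 0) -> exists W : 'M_n, H = W *m W ^t*.
Proof. exact: psd_factor. Qed.

Lemma clyapunov_triangular k (T X : 'M[K]_k) :
    (forall i j : 'I_k, (j < i)%N -> T i j = 0) ->
    (forall i, T i i + (T i i)^* < 0) -> X ^t* = X ->
    (forall x : 'cV_k, x != 0 -> (x ^t* *m (T ^t* *m X + X *m T) *m x) 0 0 < 0) ->
  forall x : 'cV_k, 0 <= (x ^t* *m X *m x) 0 0.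
Proof. exact: lyapunov_triangular. Qed.
End ComplexAdjoint.

Lemma bilinear_expand (F : comNzRingType) n (M : 'M[F]_n) (a b : 'cV_n) (a' b' : 'rV_n)
    (i i' : F) :
  ((a' + i' *: b') *m M *m (a + i *: b)) 0 0 =
  (a' *m M *m a) 0 0 + i * (a' *m M *m b) 0 0 +
  (i' * (b' *m M *m a) 0 0 + i' * (i * (b' *m M *m b) 0 0)).
Proof.
rewrite !mulmxDl !mulmxDr -!scalemxAl -!scalemxAr.
move: (a' *m _ *m a) (a' *m _ *m b) (b' *m _ *m a) (b' *m _ *m b) => p s t u.
by rewrite !mxE.
Qed.

Section ComplexMatrices.
Variable R : realType.

Lemma complexmxM m n p (A : 'M[R]_(m, n)) (B : 'M_(n, p)) :
  complexmx (A *m B) = complexmx A *m complexmx B.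
Proof. exact: map_mxM. Qed.

Lemma complexmxD m n (A B : 'M[R]_(m, n)) :
  complexmx (A + B) = complexmx A + complexmx B.
Proof. exact: map_mxD. Qed.

Lemma complexmxN m n (A : 'M[R]_(m, n)) : complexmx (- A) = - complexmx A.
Proof. exact: map_mxN. Qed.

Lemma complexmx0 m n : complexmx (0 : 'M[R]_(m, n)) = 0.
Proof. exact: map_mx0. Qed.

Lemma complexmx_adj m n (A : 'M[R]_(m, n)) : (complexmx A) ^t* = complexmx A^T.
Proof. by apply/matrixP => i j; rewrite !mxE conj_Creal // complex_real. Qed.

Lemma complexmx_inj m n : injective (@complexmx R m n).
Proof. by move=> A B /matrixP AB; apply/matrixP => i j; have := AB i j; rewrite !mxE => -[]. Qed.

Lemma complexmx_form n (M : 'M[R]_n) (z : 'cV[R[i]]_n) : M^T = M ->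
  let a := map_mx (@complex.Re R) z in let b := map_mx (@complex.Im R) z in
  (z ^t* *m complexmx M *m z) 0 0 = ((a^T *m M *m a) 0 0 + (b^T *m M *m b) 0 0)%:C%C.
Proof.
move=> Msym a b.
have zE : z = complexmx a + 'i%C *: complexmx b.
  by apply/matrixP => i j; rewrite !mxE [LHS]complexE.
have ab : a^T *m M *m b = (b^T *m M *m a)^T by rewrite !trmx_mul trmxK Msym mulmxA.
rewrite zE cadjD cadjZ !complexmx_adj bilinear_expand -!complexmxM ab.
have entryC (V : 'M[R]_1) : complexmx V 0 0 = (V 0 0)%:C%C by rewrite mxE.
rewrite !entryC [_^T 0 0]mxE.
move: ((a^T *m M *m a) 0 0) ((b^T *m M *m a) 0 0) ((b^T *m M *m b) 0 0) => p s u.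
apply/eqP; rewrite eq_complex /=.
rewrite !(mul0r, mulr0, mul1r, mulN1r, subr0, addr0, add0r, oppr0, opprK).
by rewrite addrN !eqxx.
Qed.

Lemma complexmx_form_ge0 n (M : 'M[R]_n) (z : 'cV[R[i]]_n) :
  possemidefmx M -> 0 <= (z ^t* *m complexmx M *m z) 0 0.
Proof.
by case=> Ms Mp; rewrite complexmx_form // ler0c addr_ge0.
Qed.

Lemma complexmx_form_gt0 n (M : 'M[R]_n) (z : 'cV[R[i]]_n) :
  posdefmx M -> z != 0 -> 0 < (z ^t* *m complexmx M *m z) 0 0.
Proof.
case=> Ms Mp z0; rewrite complexmx_form // (ltcR 0).
set a := map_mx _ z; set b := map_mx _ z.
have Mge (c : 'cV_n) : 0 <= (c^T *m M *m c) 0 0.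
  have [->|/Mp/ltW //] := eqVneq c 0.
  by rewrite mulmx0 mxE.
case: (eqVneq a 0) => [a0|/Mp a0]; last by rewrite ltr_wpDr.
case: (eqVneq b 0) => [b0|/Mp b0]; last by rewrite ltr_wpDl.
case/negP: z0; apply/eqP/matrixP => i j.
move/matrixP/(_ i j): a0; move/matrixP/(_ i j): b0; rewrite !mxE.
by case: (z i j) => u v /= -> ->.
Qed.
End ComplexMatrices.

Section IndexAtMostOne.
Variable R : realType.
Local Notation K := R[i].

Lemma castmx_addn0 n (J : 'M[K]_n) (U : 'M_(n, 0)) (V : 'M_(0, n)) (N : 'M_0) :
  castmx (addn0 n, addn0 n) (block_mx J U V N) = J.
Proof.
apply/matrixP => i j; rewrite castmxE.
have c k : cast_ord (esym (addn0 n)) k = lshift 0 k by apply: val_inj.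
by rewrite !c block_mxEul.
Qed.

(** One shape covers both indices: index 1 means [N = 0], and index 0 is an empty second block with
    [J] the Jordan form of [E^-1 A]. *)
Lemma has_index_le1_form n (E A : 'M[R]_n) nu : has_index E A nu -> (nu <= 1)%N ->
  exists (q r : nat) (qr : (q + r = n)%N) (W T : 'M[K]_n) (J : 'M[K]_q),
    [/\ W \in unitmx, T \in unitmx,
        complexmx E = W *m castmx (qr, qr) (block_mx 1%:M 0 0 0) *m T,
        complexmx A = W *m castmx (qr, qr) (block_mx J 0 0 1%:M) *m T &
        jordan_form J].
Proof.
move=> [[Eu _]|[_ [q [r [qr [W [T [J [N [[[Wu Tu] EE AE HJ _] nu1 Nnu _]]]]]]]]]] nu2.
  have cEu : complexmx E \in unitmx by rewrite map_unitmx.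
  have [P [J [Pu PM HJ]]] := jordan_exists (invmx (complexmx E) *m complexmx A).
  exists n, 0%N, (addn0 n), (complexmx E *m invmx P), P, J.
  rewrite !castmx_addn0 unitmx_mul unitmx_inv Pu cEu; split=> //.
    by rewrite mulmx1 mulmxKV.
  by rewrite -!mulmxA -PM mulKmx // mulKVmx.
have nuE : nu = 1%N by apply/eqP; rewrite eqn_leq nu2.
have N0 : N = 0 by rewrite -[N]expr1 -nuE.
by exists q, r, qr, W, T, J; split; [ | | rewrite EE N0 | | ].
Qed.

Lemma jordan_form0 k : jordan_form (0 : 'M[K]_k).
Proof. by move=> i j; split=> *; [rewrite mxE | left; rewrite mxE]. Qed.

(** With [E] reduced to [diag(1, 0)] by its rank factorization, the hypothesis makes the lower right
    block of [A] invertible. Eliminating with it leaves a Schur complement, whose Jordan form is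
    [J]. *)
Lemma index_le1_of_injective n (E A : 'M[R]_n) :
    (forall v w : 'cV[K]_n, complexmx E *m v = 0 ->
       complexmx A *m v = complexmx E *m w -> v = 0) ->
  exists2 nu, has_index E A nu & (nu <= 1)%N.
Proof.
move=> inj; case: (boolP (E \in unitmx)) => Eu; first by exists 0%N => //; left.
exists 1%N => //; right; split=> //.
pose q := \rank (complexmx E); pose r := (n - q)%N.
have nE : n = (q + r)%N by rewrite subnKC // rank_leq_row.
have rkE : \rank (complexmx E) = q by [].
move: q r nE rkE => q r nE; subst n => rkE.
have EE := mulmx_ebase (complexmx E); rewrite rkE pid_mx_block in EE.
set L := col_ebase _ in EE; set U := row_ebase _ in EE.
have Lu : L \in unitmx by apply: col_ebase_unit.
have Uu : U \in unitmx by apply: row_ebase_unit.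
pose A' := invmx L *m complexmx A *m invmx U.
have AE : complexmx A = L *m A' *m U.
  by rewrite /A' !mulmxA mulmxV // mul1mx mulmxKV.
clearbody A'; have A22u : drsubmx A' \in unitmx.
  rewrite -unitmx_tr -row_free_unit -kermx_eq0; apply/rowV0P => y /sub_kermxP yA.
  have {}yA : drsubmx A' *m y^T = 0 by apply: trmx_inj; rewrite trmx_mul trmxK yA trmx0.
  have : invmx U *m col_mx 0 y^T = 0.
    (* In the reduced coordinates [(0, y)] is in the kernel of [E], and [A] sends it to
       [(A12 y, 0)], which is in the range of [E]. *)
    apply: (inj _ (invmx U *m col_mx (ursubmx A' *m y^T) 0)).
      rewrite -EE mulmxA mulmxK // -mulmxA mul_block_col !mul0mx !mulmx0 addr0.
      by rewrite addr0 col_mx0 mulmx0.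
    rewrite -{1}EE AE !mulmxA !mulmxK // -!mulmxA -{1}[A']submxK !mul_block_col.
    by rewrite !mulmx0 !mul0mx yA !mul1mx !add0r !addr0.
  move/(congr1 (mulmx U)); rewrite mulKVmx // mulmx0 -col_mx0.
  by move/eq_col_mx => [_] /(congr1 trmx); rewrite trmxK trmx0.
set A11 := ulsubmx A'; set A12 := ursubmx A'; set A21 := dlsubmx A'.
set A22 := drsubmx A' in A22u *.
have [P [J [Pu PM HJ]]] := jordan_exists (A11 - A12 *m invmx A22 *m A21).
exists q, r, (erefl _).
exists (L *m block_mx (invmx P) (A12 *m invmx A22) 0 1%:M).
exists (block_mx P 0 A21 A22 *m U), J, 0.
split; [split|by []|by rewrite expr1|by case].
- rewrite !unitmx_mul Lu Uu andbT /=; split.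
    by rewrite unitmxE det_ublock det1 mulr1 -unitmxE unitmx_inv.
  by rewrite unitmxE det_lblock unitrM -!unitmxE Pu.
- rewrite castmx_id -EE -!mulmxA; congr (_ *m _); rewrite !mulmxA; congr (_ *m _).
  rewrite !mulmx_block !mul0mx !mulmx0 !mulmx1 !addr0 !add0r.
  by rewrite !mul0mx mulVmx // !addr0.
- rewrite castmx_id AE -!mulmxA; congr (_ *m _); rewrite !mulmxA; congr (_ *m _).
  rewrite !mulmx_block !mul0mx !mulmx0 !mulmx1 !addr0 !add0r !mul1mx.
  by rewrite -mulmxA -PM mulKmx // mulmxKV // subrK mul0mx add0r submxK.
- exact: HJ.
- by split; [exact: jordan_form0 | exists 1%N; rewrite expr1].
Qed.
End IndexAtMostOne.

(** * The transfer function at infinity and the descriptor Lyapunov inequality *)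

Import Normc.

Section EntrywiseNorm.
Variable R : realType.

(** A submultiplicative norm that bounds every entry, so that the limit at infinity becomes a scalar
    estimate. *)
Definition entry_norm m n (M : 'M[R[i]]_(m, n)) : R := \sum_i \sum_j normc (M i j).

Lemma normc_ge0 (z : R[i]) : 0 <= normc z.
Proof. by case: z => a b; apply: sqrtr_ge0. Qed.

Lemma entry_norm_ge0 m n (M : 'M[R[i]]_(m, n)) : 0 <= entry_norm M.
Proof. by apply: sumr_ge0 => i _; apply: sumr_ge0 => j _; apply: normc_ge0. Qed.

Lemma entry_norm_ge m n (M : 'M[R[i]]_(m, n)) i j : normc (M i j) <= entry_norm M.
Proof.
rewrite /entry_norm (bigD1 i) //= (bigD1 j) //= -addrA lerDl.
apply: addr_ge0; first by apply: sumr_ge0 => k _; apply: normc_ge0.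
by apply: sumr_ge0 => k _; apply: sumr_ge0 => l _; apply: normc_ge0.
Qed.

Lemma le_normc_sum (I : finType) (F : I -> R[i]) :
  normc (\sum_i F i) <= \sum_i normc (F i).
Proof.
elim/big_ind2: _ => [|x1 x2 y1 y2 le1 le2|//]; first by rewrite normc0.
by apply: le_trans (le_normcD _ _) _; apply: lerD.
Qed.

Lemma entry_normD m n (M N : 'M[R[i]]_(m, n)) :
  entry_norm (M + N) <= entry_norm M + entry_norm N.
Proof.
rewrite /entry_norm -big_split /=; apply: ler_sum => i _; rewrite -big_split /=.
by apply: ler_sum => j _; rewrite mxE; apply: le_normcD.
Qed.

Lemma entry_normM m n p (M : 'M[R[i]]_(m, n)) (N : 'M_(n, p)) :
  entry_norm (M *m N) <= entry_norm M * entry_norm N.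
Proof.
have rowN k : \sum_j normc (N k j) <= entry_norm N.
  rewrite /entry_norm [leRHS](bigD1 k) //= lerDl.
  by apply: sumr_ge0 => l _; apply: sumr_ge0 => j _; apply: normc_ge0.
rewrite [in leRHS]/entry_norm mulr_suml; apply: ler_sum => i _; rewrite mulr_suml.
apply: (@le_trans _ _ (\sum_k normc (M i k) * \sum_j normc (N k j))); last first.
  by apply: ler_sum => k _; rewrite ler_wpM2l ?normc_ge0.
under [leRHS]eq_bigr do rewrite mulr_sumr.
rewrite exchange_big /=; apply: ler_sum => j _; rewrite mxE.
by apply: le_trans (le_normc_sum _) _; apply: ler_sum => k _; rewrite normcM.
Qed.

Lemma entry_normZ m n a (M : 'M[R[i]]_(m, n)) :
  entry_norm (a *: M) = normc a * entry_norm M.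
Proof.
rewrite /entry_norm mulr_sumr; apply: eq_bigr => i _; rewrite mulr_sumr.
by apply: eq_bigr => j _; rewrite mxE normcM.
Qed.

Lemma normc_imag (w : R) : 0 <= w -> normc (0 +i* w)%C = w.
Proof. by move=> w0; rewrite /normc expr0n add0r sqrtr_sqr ger0_norm. Qed.

Lemma Re_le_normc (z : R[i]) : `|complex.Re z| <= normc z.
Proof.
case: z => a b /=; rewrite -sqrtr_sqr ler_wsqrtr //.
by rewrite lerDl sqr_ge0.
Qed.

Lemma Im_le_normc (z : R[i]) : `|complex.Im z| <= normc z.
Proof.
case: z => a b /=; rewrite -sqrtr_sqr ler_wsqrtr //.
by rewrite lerDr sqr_ge0.
Qed.

(** Taking norms in [i w Y = 1 + J Y] gives [w |Y| <= |1| + |J| |Y|]. *)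
Lemma resolvent_bound q (J Y : 'M[R[i]]_q) w : entry_norm J < w ->
  ((0 +i* w)%C%:M - J) *m Y = 1%:M ->
  entry_norm Y <= entry_norm (1%:M : 'M[R[i]]_q) / (w - entry_norm J).
Proof.
move=> Jw; have w0 : 0 <= w by apply: le_trans (ltW Jw); apply: entry_norm_ge0.
rewrite mulmxBl mul_scalar_mx => /(canRL (subrK _)) e.
rewrite ler_pdivlMr ?subr_gt0 // mulrBr lerBlDr mulrC -{1}(normc_imag w0).
rewrite -entry_normZ e; apply: le_trans (entry_normD _ _) _.
by rewrite lerD2l mulrC; apply: entry_normM.
Qed.
End EntrywiseNorm.

(** * Systems in Weierstrass form of index at most one *)

Section WeierstrassIndexOne.
Local Open Scope classical_set_scope.
Variables (R : realType) (q r m : nat) (E A : 'M[R]_(q + r)).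
Local Notation K := R[i].
Variables (W T : 'M[K]_(q + r)) (J : 'M[K]_q).
Hypotheses (Wu : W \in unitmx) (Tu : T \in unitmx).
Hypothesis EE : complexmx E = W *m block_mx 1%:M 0 0 0 *m T.
Hypothesis AE : complexmx A = W *m block_mx J 0 0 1%:M *m T.

Lemma index_one_injective (v w : 'cV[K]_(q + r)) :
  complexmx E *m v = 0 -> complexmx A *m v = complexmx E *m w -> v = 0.
Proof.
rewrite EE AE -!mulmxA => /(canRL (mulKmx Wu)) Ev /(can_inj (mulKmx Wu)).
move: Ev; rewrite mulmx0 -[T *m v]vsubmxK -[T *m w]vsubmxK !mul_block_col.
rewrite !mul0mx !mul1mx !addr0 add0r -[X in _ = X]col_mx0.
move=> /eq_col_mx[u0 _] /eq_col_mx[_ d0].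
by rewrite -[v](mulKmx Tu) -[T *m v]vsubmxK u0 d0 col_mx0 mulmx0.
Qed.

Lemma pencil_form s :
  s *: complexmx E - complexmx A = W *m block_mx (s%:M - J) 0 0 (- 1%:M) *m T.
Proof.
rewrite EE AE scalemxAl scalemxAr -mulmxBl -mulmxBr scale_block_mx !scaler0.
by rewrite opp_block_mx add_block_mx scalemx1 !oppr0 !addr0 add0r.
Qed.

Section Infinity.
Variables (B : 'M[R]_(q + r, m)) (C : 'M[R]_(m, q + r)) (D : 'M[R]_m).
Let B' := invmx W *m complexmx B.
Let C' := complexmx C *m invmx T.

(** The value at infinity: the finite block of the resolvent tends to 0 and the other one is the
    constant [- 1]. *)
Definition feedthrough : 'M[K]_m := complexmx D - rsubmx C' *m dsubmx B'.

(** These are the states at infinite frequency: [E x = 0] leaves only the second component, which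
    the algebraic equations fix as [- B2 u]. *)
Lemma feedthroughE (x y : 'cV[K]_(q + r)) (u : 'cV[K]_m) :
    complexmx E *m x = 0 ->
    complexmx A *m x + complexmx B *m u = complexmx E *m y ->
  complexmx C *m x + complexmx D *m u = feedthrough *m u.
Proof.
have BE : complexmx B = W *m B' by rewrite mulKVmx.
have CE : complexmx C = C' *m T by rewrite mulmxKV.
rewrite /feedthrough; clearbody B' C'; rewrite BE CE EE AE -!mulmxA -mulmxDr.
move=> /(canRL (mulKmx Wu)) Ex.
move=> /(can_inj (mulKmx Wu)); move: Ex; rewrite mulmx0.
rewrite -[T *m x]vsubmxK -[T *m y]vsubmxK -[B' *m u]vsubmxK !mul_block_col.
rewrite !mul0mx !mul1mx !addr0 add0r -[X in _ = X]col_mx0 add_col_mx.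
move=> /eq_col_mx[u0 _] /eq_col_mx[_ /eqP d0]; move: d0.
rewrite addr_eq0 => /eqP d0.
rewrite -[C' in LHS]hsubmxK mul_row_col u0 mulmx0 add0r d0 mulmxBl -mulmxA.
by rewrite -mul_dsub_mx mulmxN addrC.
Qed.

Lemma feedthrough_state (u : 'cV[K]_m) : exists x y : 'cV[K]_(q + r),
  complexmx E *m x = 0 /\ complexmx A *m x + complexmx B *m u = complexmx E *m y.
Proof.
have BE : complexmx B = W *m B' by rewrite mulKVmx.
exists (invmx T *m col_mx 0 (- (dsubmx B' *m u))).
exists (invmx T *m col_mx (usubmx B' *m u) 0).
clearbody B'; rewrite EE AE BE -!mulmxA !mulKVmx // !mul_block_col.
rewrite !mul0mx !mulmx0 !mul1mx !addr0 !add0r col_mx0 mulmx0; split=> //.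
by rewrite -mulmxDr -[B' in B' *m u]vsubmxK mul_col_mx add_col_mx add0r addNr.
Qed.

(** Stability keeps eigenvalues off the imaginary axis. There the transfer function differs from
    [feedthrough] only by the term through [(i w - J)^-1], which is of order [1 / w]. *)
Lemma transfer_at_infinity_feedthrough : asymptotically_stable E A ->
  transfer_at_infinity E A B C D feedthrough.
Proof.
move=> stab.
have du w : \det ((0 +i* w)%C *: complexmx E - complexmx A) != 0.
  apply/negP => d0; have : finite_eigenvalue E A (0 +i* w)%C.
    by rewrite /finite_eigenvalue /root det_pencil_horner.
  by move/stab; rewrite ltxx.
have Ju w : (0 +i* w)%C%:M - J \in unitmx.
  have := du w; rewrite pencil_form !det_mulmx det_ublock !mulf_eq0 !negb_or.
  by rewrite unitmxE unitfE => /andP[/andP[_ /andP[]]].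
have inv w : invmx ((0 +i* w)%C *: complexmx E - complexmx A) =
    invmx T *m block_mx (invmx ((0 +i* w)%C%:M - J)) 0 0 (- 1%:M) *m invmx W.
  set X := RHS; have e : ((0 +i* w)%C *: complexmx E - complexmx A) *m X = 1%:M.
    rewrite pencil_form /X !mulmxA mulmxK // -(mulmxA W) mulmx_block.
    rewrite !mul0mx !mulmx0 !addr0 add0r mulmxV // mulmxN mulmx1 opprK.
    by rewrite -scalar_mx_block mulmx1 mulmxV.
  have [Mu _] := mulmx1_unit e.
  by rewrite -[RHS](mulKmx Mu) e mulmx1.
have dist w i j : entry_norm J < w ->
    normc (transfer_at E A B C D (0 +i* w)%C i j - feedthrough i j) <=
    entry_norm (lsubmx C') * (entry_norm (1%:M : 'M[K]_q) / (w - entry_norm J)) *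
      entry_norm (usubmx B').
  move=> Jw; have [_ ->] := transfer_at_resolvent B C D (du w).
  set Y := invmx ((0 +i* w)%C%:M - J) in inv *.
  have -> : complexmx C *m invmx ((0 +i* w)%C *: complexmx E - complexmx A)
      *m complexmx B + complexmx D =
      lsubmx C' *m Y *m usubmx B' + feedthrough.
    rewrite inv !mulmxA -/C' -(mulmxA _ (invmx W)) -/B' /feedthrough.
    clearbody B' C'; rewrite -{1}[C']hsubmxK -{1}[B']vsubmxK mul_row_block mul_row_col.
    by rewrite !mulmx0 addr0 add0r mulmxN mulmx1 mulNmx [complexmx D - _]addrC addrA.
  rewrite mxE addrK; apply: le_trans (entry_norm_ge _ _ _) _.
  apply: le_trans (entry_normM _ _) _; rewrite ler_wpM2r ?entry_norm_ge0 //.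
  apply: le_trans (entry_normM _ _) _; rewrite ler_wpM2l ?entry_norm_ge0 //.
  by apply: resolvent_bound; rewrite // mulmxV.
set k : R := entry_norm (lsubmx C') * entry_norm (1%:M : 'M[K]_q) * entry_norm (usubmx B').
have k0 : 0 <= k by rewrite !mulr_ge0 ?entry_norm_ge0.
have near0 eps : 0 < eps -> \forall w \near +oo, forall i j,
    normc (transfer_at E A B C D (0 +i* w)%C i j - feedthrough i j) < eps.
  move=> eps0; near=> w => i j.
  have Jw : entry_norm J < w by near: w; apply: nbhs_pinfty_gt; apply: num_real.
  (* The bound [k / (w - |J|)] is below [eps] once [w > |J| + k / eps]. *)
  apply: le_lt_trans (dist w i j Jw) _; rewrite mulrA mulrAC -/k.
  rewrite ltr_pdivrMr ?subr_gt0 // -ltr_pdivrMl // ltrBrDl.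
  by near: w; apply: nbhs_pinfty_gt; apply: num_real.
move=> i j; split; apply/cvgrPdist_lt => eps /near0; apply: filterS => w /(_ i j).
  by apply: le_lt_trans; rewrite distrC -raddfB; apply: Re_le_normc.
by apply: le_lt_trans; rewrite distrC -raddfB; apply: Im_le_normc.
Unshelve. all: by end_near. Qed.
End Infinity.

Lemma jordan_diag_eigenvalue i : jordan_form J -> finite_eigenvalue E A (J i i).
Proof.
move=> HJ; have d0 : \det ((J i i)%:M - J) = 0.
  rewrite -det_tr det_trig; first by rewrite (bigD1 i) //= !mxE eqxx mulr1n subrr mul0r.
  apply/is_trig_mxP => k l kl; rewrite !mxE -val_eqE /= (gtn_eqF kl) mulr0n sub0r.
  rewrite (HJ l k).1 ?oppr0 // -?val_eqE /= ?(ltn_eqF kl) //.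
  by rewrite ltn_eqF // (ltn_trans kl).
rewrite /finite_eigenvalue /root det_pencil_horner pencil_form !det_mulmx.
by rewrite det_ublock d0 mul0r mulr0 mul0r.
Qed.

(** In Weierstrass coordinates the symmetry of [E^T X] annihilates its off-diagonal block, so only
    the leading block [X1] remains. On vectors of the finite part the inequality is Lyapunov's for
    [X1] and [J], which is triangular with its diagonal in the open left half plane. *)
Lemma lyapunov_descriptor (X : 'M[R]_(q + r)) :
    jordan_form J -> asymptotically_stable E A ->
    negdefmx (A^T *m X + X^T *m A) -> E^T *m X = X^T *m E ->
  possemidefmx (E^T *m X).
Proof.
move=> HJ stab neg EX.
pose X' := W ^t* *m complexmx X *m invmx T.
have WX : W ^t* *m complexmx X = X' *m T by rewrite mulmxKV.
clearbody X'; have T'u : T ^t* \in unitmx by rewrite map_unitmx unitmx_tr.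
pose S : 'M[K]_(q + r) := block_mx 1%:M 0 0 0.
have Sh : S ^t* = S.
  by rewrite /S cadj_block_mx !cadj1 !cadj0.
have EXE : complexmx (E^T *m X) = T ^t* *m (S *m X') *m T.
  have Eadj : (complexmx E) ^t* = T ^t* *m S *m W ^t*.
    by rewrite EE cadjM cadjM Sh mulmxA.
  by rewrite complexmxM -complexmx_adj Eadj -[LHS]mulmxA WX [LHS]mulmxA [in RHS]mulmxA.
have Hh : (S *m X') ^t* = S *m X'.
  have : (complexmx (E^T *m X)) ^t* = complexmx (E^T *m X).
    by rewrite complexmx_adj trmx_mul trmxK -EX.
  rewrite EXE; move: (S *m X') => H; rewrite !cadjM cadjK mulmxA.
  by move=> /(can_inj (mulmxK Tu)) /(can_inj (mulKmx T'u)).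
pose X1 := ulsubmx X'.
have SX : S *m X' = block_mx X1 (ursubmx X') 0 0.
  by rewrite -[X' in LHS]submxK mulmx_block !mul0mx !mul1mx !addr0.
have [X1h X12] : X1 ^t* = X1 /\ ursubmx X' = 0.
  move: Hh; rewrite SX cadj_block_mx !cadj0.
  by move=> /eq_block_mx[-> <-].
have AXE : complexmx (A^T *m X) = T ^t* *m (block_mx (J ^t*) 0 0 1%:M *m X') *m T.
  have Aadj : (complexmx A) ^t* = T ^t* *m block_mx (J ^t*) 0 0 1%:M *m W ^t*.
    by rewrite AE cadjM cadjM cadj_block_mx !cadj0 cadj1 mulmxA.
  move: (block_mx _ _ _ _) Aadj => M Aadj.
  by rewrite complexmxM -complexmx_adj Aadj -[LHS]mulmxA WX [LHS]mulmxA [in RHS]mulmxA.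
have X1_ge0 : forall y : 'cV[K]_q, 0 <= (y ^t* *m X1 *m y) 0 0.
  apply: (@clyapunov_triangular R q J) => // [i j ji|i|y y0].
  - by rewrite (HJ i j).1 // -?val_eqE /= ltn_eqF // (ltn_trans ji).
  - have := stab _ (jordan_diag_eigenvalue i HJ).
    case: (J i i) => a b /= a0; rewrite ltcE /= addrN eqxx /=.
    by rewrite -mulr2n pmulrn_llt0.
  pose e : 'M[K]_(q + r, q) := col_mx 1%:M 0.
  pose x := invmx T *m (e *m y).
  have x0 : x != 0.
    apply: contra y0 => /eqP /(congr1 (mulmx T)); rewrite mulKVmx // mulmx0.
    rewrite mul_col_mx mul1mx mul0mx -[X in _ = X]col_mx0.
    by move=> /eq_col_mx[-> _].
  have := complexmx_form_gt0 neg x0.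
  have -> : complexmx (- (A^T *m X + X^T *m A)) =
      - (complexmx (A^T *m X) + (complexmx (A^T *m X)) ^t*).
    by rewrite complexmx_adj trmx_mul trmxK complexmxN complexmxD.
  rewrite AXE mulmxN mulNmx mxE oppr_gt0; congr (_ < 0).
  set N := _ *m X'.
  have Nee : e ^t* *m N *m e = J ^t* *m X1.
    rewrite /N -[X']submxK mulmx_block /e cadj_col_mx cadj0 cadj1 mul_row_block.
    by rewrite mul_row_col !mul0mx !mulmx0 !addr0 mul1mx mulmx1.
  have NxE : x ^t* *m (T ^t* *m N *m T) *m x = y ^t* *m (J ^t* *m X1) *m y.
    by rewrite cadj_congr /x mulKVmx // -Nee cadj_congr.
  move: (T ^t* *m N *m T) NxE => M MxE; congr (_ 0 0).
  have MxE' : x ^t* *m M ^t* *m x = y ^t* *m (X1 *m J) *m y.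
    have := congr1 (fun M => M ^t*) MxE.
    by rewrite !cadjM !cadjK X1h !mulmxA.
  by rewrite !mulmxDr !mulmxDl MxE MxE'.
split; first by rewrite trmx_mul trmxK.
move=> x.
have : 0 <= ((complexmx x) ^t* *m complexmx (E^T *m X) *m complexmx x) 0 0.
  rewrite EXE SX X12; move: (complexmx x) => z.
  rewrite cadj_congr -[T *m z]vsubmxK cadj_col_mx mul_row_block !mulmx0 addr0 add0r.
  by rewrite mul_row_col mul0mx addr0.
rewrite complexmx_adj -(complexmxM x^T) -(complexmxM (_ *m _)).
by rewrite mxE ler0c.
Qed.
End WeierstrassIndexOne.

(** * Dissipation *)

(** The primed variables stand for adjoints; kept independent, they reduce the claim to an identity
    without conjugation. *)
Lemma supply_block_form (F : comPzRingType) n m (x' : 'rV[F]_n) (u' : 'rV[F]_m)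
    (x : 'cV_n) (u : 'cV_m) C C' D D' :
  row_mx x' u' *m block_mx 0 (- C') (- C) (- D - D') *m col_mx x u =
  - (u' *m (C *m x + D *m u) + (x' *m C' + u' *m D') *m u).
Proof.
rewrite -mulmxA mul_block_col mul_row_col mul0mx add0r.
rewrite !mulmxDl !mulmxDr !mulNmx !mulmxN !mulmxA.
by rewrite addrC !opprD !addrA addrAC.
Qed.

Lemma storage_block_form (F : comPzRingType) n m (x' : 'rV[F]_n) (u' : 'rV[F]_m)
    (x : 'cV_n) (u : 'cV_m) (A A' X X' : 'M_n) (B : 'M_(n, m)) (B' : 'M_(m, n)) :
  row_mx x' u' *m block_mx (A' *m X + X' *m A) (X' *m B) (B' *m X) 0 *m col_mx x u =
  x' *m X' *m (A *m x + B *m u) + (x' *m A' + u' *m B') *m X *m x.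
Proof.
rewrite -mulmxA mul_block_col mul_row_col mul0mx addr0.
rewrite !mulmxDl !mulmxDr !mulmxA.
by rewrite -!addrA addrCA; congr (_ + _); rewrite addrCA.
Qed.

Section QuadraticForms.
Variables (R : realType) (n m : nat).
Variables (E A : 'M[R]_n) (B : 'M[R]_(n, m)) (C : 'M[R]_(m, n)) (D : 'M[R]_m).
Local Notation K := R[i].
Local Notation cE := (complexmx E).
Local Notation cA := (complexmx A).
Local Notation cB := (complexmx B).
Local Notation cC := (complexmx C).
Local Notation cD := (complexmx D).

(** The part of the matrix inequality free of [X]: minus the supplied power [y^T u + u^T y] as a
    quadratic form in [(x, u)]. *)
Definition supply_mx : 'M[R]_(n + m) := block_mx 0 (- C^T) (- C) (- D - D^T).

(** The part linear in [X]: for symmetric [E^T X], the derivative of the storage [x^T E^T X x] along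
    trajectories. *)
Definition storage_mx (X : 'M[R]_n) : 'M[R]_(n + m) :=
  block_mx (A^T *m X + X^T *m A) (X^T *m B) (B^T *m X) 0.

Lemma lmi_split X :
  block_mx (A^T *m X + X^T *m A) (X^T *m B - C^T) (B^T *m X - C) (- D - D^T) =
  supply_mx + storage_mx X.
Proof. by rewrite add_block_mx add0r addr0 [- C^T + _]addrC [- C + _]addrC. Qed.

Lemma supply_mx_sym : supply_mx^T = supply_mx.
Proof.
by rewrite tr_block_mx trmx0 !linearN /= trmxK linearB /= linearN /= trmxK [- D^T - D]addrC.
Qed.

Lemma storage_mx_sym X : (storage_mx X)^T = storage_mx X.
Proof. by rewrite tr_block_mx linearD /= !trmx_mul !trmxK trmx0 addrC. Qed.

Lemma storage_mxZ a X : storage_mx (a *: X) = a *: storage_mx X.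
Proof.
have aX : (a *: X)^T = a *: X^T by rewrite linearZ.
rewrite /storage_mx scale_block_mx scaler0 scalerDr aX.
by rewrite -!scalemxAl -!scalemxAr.
Qed.

Lemma storage_mxD X Y : storage_mx (X + Y) = storage_mx X + storage_mx Y.
Proof.
have XY : (X + Y)^T = X^T + Y^T by rewrite linearD.
rewrite /storage_mx add_block_mx addr0 XY !mulmxDl !mulmxDr.
by rewrite addrACA.
Qed.

(** Twice the real part of [u^* y] for the output [y = C x + D u]: the supplied power, all of it
    dissipated when the storage term vanishes. *)
Definition dissipation (x : 'cV[K]_n) (u : 'cV[K]_m) : K :=
  (u ^t* *m (cC *m x + cD *m u)) 0 0 + ((cC *m x + cD *m u) ^t* *m u) 0 0.

Lemma supply_form x u :
  ((col_mx x u) ^t* *m complexmx supply_mx *m col_mx x u) 0 0 = - dissipation x u.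
Proof.
have -> : complexmx supply_mx = block_mx 0 (- cC ^t*) (- cC) (- cD - cD ^t*).
  rewrite !complexmx_adj /supply_mx [LHS]map_block_mx -!/(complexmx _).
  by rewrite complexmx0 complexmxD !complexmxN.
rewrite cadj_col_mx supply_block_form /dissipation cadjD (cadjM cC) (cadjM cD).
by rewrite mxE [in LHS]mxE.
Qed.

Lemma storage_form X (x : 'cV[K]_n) (u : 'cV[K]_m) :
  ((col_mx x u) ^t* *m complexmx (storage_mx X) *m col_mx x u) 0 0 =
  (x ^t* *m (complexmx X) ^t* *m (cA *m x + cB *m u)) 0 0 +
  ((cA *m x + cB *m u) ^t* *m complexmx X *m x) 0 0.
Proof.
have -> : complexmx (storage_mx X) =
    block_mx (cA ^t* *m complexmx X + (complexmx X) ^t* *m cA)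
      ((complexmx X) ^t* *m cB) (cB ^t* *m complexmx X) 0.
  rewrite !complexmx_adj /storage_mx [LHS]map_block_mx -!/(complexmx _).
  by rewrite complexmx0 complexmxD !complexmxM.
rewrite cadj_col_mx storage_block_form cadjD (cadjM cA) (cadjM cB).
by rewrite [LHS]mxE.
Qed.

(** With [y] as the velocity of the state, the form is [x^* H y + y^* H x], where [H = E^T X]. An
    imaginary ratio of [y] to [x] cancels the two terms, and [E x = 0] kills both. *)
Lemma storage_form0 X (x y : 'cV[K]_n) (u : 'cV[K]_m) : E^T *m X = X^T *m E ->
    cA *m x + cB *m u = cE *m y ->
    cE *m x = 0 \/ (exists2 a : K, a^* = - a & y = a *: x) ->
  ((col_mx x u) ^t* *m complexmx (storage_mx X) *m col_mx x u) 0 0 = 0.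
Proof.
move=> EX Axu Ha.
have EXc : cE ^t* *m complexmx X = (complexmx X) ^t* *m cE.
  by rewrite !complexmx_adj -!complexmxM EX.
rewrite storage_form Axu; move: (complexmx X) cE EXc Ha => X' e EXc Ha {Axu}.
have h1 z : x ^t* *m X' ^t* *m (e *m z) = (e *m x) ^t* *m (X' *m z).
  by rewrite cadjM mulmxA mulmxA -(mulmxA _ (e ^t*)) EXc mulmxA.
have h2 : (e *m y) ^t* *m X' *m x = y ^t* *m X' ^t* *m (e *m x).
  by rewrite cadjM -(mulmxA _ (e ^t*)) EXc mulmxA -mulmxA.
rewrite h1 h2; case: Ha => [->|[a a0 ->]].
  by rewrite mulmx0 cadj0 mul0mx mxE addr0.
rewrite -2!scalemxAr -h1 cadjZ a0 -2!scalemxAl scaleNr.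
by rewrite [X in _ + X]mxE addrN.
Qed.
End QuadraticForms.

(** * Triviality of dual certificates *)

Lemma mxtrace_sqr_eq0 (R : realDomainType) m n (S : 'M[R]_(m, n)) :
  \tr (S^T *m S) = 0 -> S = 0.
Proof.
have trE : \tr (S^T *m S) = \sum_j \sum_i S i j ^+ 2.
  by apply: eq_bigr => j _; rewrite mxE; apply: eq_bigr => i _; rewrite mxE.
rewrite trE => /eqP; rewrite psumr_eq0 => [/allP h|j _]; last first.
  by apply: sumr_ge0 => i _; apply: sqr_ge0.
apply/matrixP => i j; have := h j (mem_index_enum _).
rewrite psumr_eq0 => [/allP/(_ i (mem_index_enum _))|k _]; last exact: sqr_ge0.
by rewrite sqrf_eq0 mxE => /eqP.
Qed.

Lemma mxtrace_gram (C : numClosedFieldType) n k (W : 'M[C]_(n, k)) M :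
  \tr (W *m W ^t* *m M) = \sum_j ((col j W) ^t* *m M *m col j W) 0 0.
Proof.
rewrite -mulmxA mxtrace_mulC; apply: eq_bigr => j _.
rewrite [LHS]mxE [RHS]mxE; apply: eq_bigr => i _; rewrite [X in _ = _ * X]mxE.
congr (_ * _); rewrite [LHS]mxE [RHS]mxE; apply: eq_bigr => l _; rewrite !mxE.
by congr (_ * _).
Qed.

Section DualCertificate.
Variables (R : realType) (n m : nat).
Variables (E A : 'M[R]_n) (B : 'M[R]_(n, m)) (C : 'M[R]_(m, n)) (D : 'M[R]_m).
Local Notation K := R[i].

Variable Z : 'M[R]_(n + m).
Hypothesis Zsym : Z^T = Z.
Hypothesis Zort : forall X, E^T *m X = X^T *m E -> \tr (Z *m storage_mx A B X) = 0.
Let P := A *m ulsubmx Z + B *m dlsubmx Z.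

Lemma mxtrace_storage X : \tr (Z *m storage_mx A B X) = \tr (X^T *m P) *+ 2.
Proof.
have Z11 : (ulsubmx Z)^T = ulsubmx Z by rewrite trmx_ulsub Zsym.
have Z12 : (dlsubmx Z)^T = ursubmx Z by rewrite trmx_dlsub Zsym.
rewrite -{1}[Z]submxK /storage_mx mulmx_block mxtrace_block -Z12 /P.
move: (ulsubmx Z) (dlsubmx Z) Z11 => Y V Ys.
rewrite !mulmxDr !mulmx0 addr0 !mxtraceD mulr2n.
have -> : \tr (Y *m (A^T *m X)) = \tr (X^T *m (A *m Y)).
  by rewrite -mxtrace_tr !trmx_mul trmxK Ys !mulmxA.
have -> : \tr (V^T *m (B^T *m X)) = \tr (X^T *m (B *m V)).
  by rewrite -mxtrace_tr !trmx_mul !trmxK !mulmxA.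
have -> : \tr (Y *m (X^T *m A)) = \tr (X^T *m (A *m Y)).
  by rewrite mxtrace_mulC !mulmxA.
have -> : \tr (V *m (X^T *m B)) = \tr (X^T *m (B *m V)).
  by rewrite mxtrace_mulC !mulmxA.
by rewrite -!addrA; congr (_ + _); rewrite addrCA.
Qed.

Lemma mxtrace_test X : E^T *m X = X^T *m E -> \tr (X^T *m P) = 0.
Proof. by move=> /Zort/eqP; rewrite mxtrace_storage mulrn_eq0 => /eqP. Qed.

(** The test matrix is [S E] with [S = P E^T + E P^T]: [E^T S E] is symmetric, and orthogonality
    annihilates the trace of [S P E^T], which is half that of [S^2]. *)
Lemma certificate_skew : P *m E^T + E *m P^T = 0.
Proof.
set S := LHS; have Ss : S^T = S by rewrite linearD /= !trmx_mul !trmxK addrC.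
have := @mxtrace_test (S *m E); rewrite !trmx_mul Ss mulmxA => /(_ erefl) tr0.
apply: mxtrace_sqr_eq0; rewrite Ss {2}/S mulmxDr mxtraceD.
have e1 : \tr (S *m (P *m E^T)) = 0 by rewrite mulmxA mxtrace_mulC mulmxA.
by rewrite e1 -mxtrace_tr !trmx_mul !trmxK Ss mxtrace_mulC e1 addr0.
Qed.

(** The test matrix is [N N^T P] with [E^T N = 0]: both sides of the symmetry condition vanish, and
    the trace is the squared norm of [N^T P]. Hence the columns of [P] lie in the range of [E]. *)
Lemma certificate_range : (cokermx E^T)^T *m P = 0.
Proof.
set N := cokermx _; have EN : E^T *m N = 0 by apply: mulmx_coker.
clearbody N; apply: mxtrace_sqr_eq0; rewrite trmx_mul trmxK -mulmxA (mulmxA N).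
have := @mxtrace_test (N *m N^T *m P).
rewrite !trmx_mul !trmxK !mulmxA EN !mul0mx -!mulmxA.
have NE : N^T *m E = 0 by rewrite -[LHS]trmxK trmx_mul trmxK EN trmx0.
by rewrite NE !mulmx0 => /(_ erefl).
Qed.
End DualCertificate.

(** The trace is the sum of the forms of [M] at the columns, each nonpositive and zero only at a
    zero column. *)
Lemma gram_sum_neg (C : numClosedFieldType) n k1 k2 (W1 : 'M[C]_(n, k1))
    (W2 : 'M[C]_(n, k2)) (M : 'M[C]_n) :
    (forall j, col j W1 != 0 -> ((col j W1) ^t* *m M *m col j W1) 0 0 < 0) ->
    (forall j, col j W2 != 0 -> ((col j W2) ^t* *m M *m col j W2) 0 0 < 0) ->
    0 <= \tr ((W1 *m W1 ^t* + W2 *m W2 ^t*) *m M) ->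
  W1 = 0 /\ W2 = 0.
Proof.
have le0 k (W : 'M[C]_(n, k)) : (forall j, col j W != 0 ->
    ((col j W) ^t* *m M *m col j W) 0 0 < 0) ->
    forall j, 0 <= - ((col j W) ^t* *m M *m col j W) 0 0.
  move=> Wneg j; rewrite oppr_ge0; case: (eqVneq (col j W) 0) => [->|/Wneg/ltW //].
  by rewrite mulmx0 mxE.
have sum0 k (W : 'M[C]_(n, k)) : (forall j, col j W != 0 ->
    ((col j W) ^t* *m M *m col j W) 0 0 < 0) ->
    \sum_j - ((col j W) ^t* *m M *m col j W) 0 0 = 0 -> W = 0.
  move=> Wneg /eqP; rewrite psumr_eq0 => [/allP h|j _]; last exact: le0.
  apply/matrixP => i j; have := h j (mem_index_enum _); rewrite /= oppr_eq0 => h0.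
  case: (eqVneq (col j W) 0) => [/colP/(_ i)|/Wneg]; first by rewrite !mxE.
  by rewrite (eqP h0) ltxx.
move=> neg1 neg2; rewrite mulmxDl mxtraceD !mxtrace_gram -oppr_le0 opprD -!sumrN.
set s1 := \sum_i _; set s2 := \sum_i _.
have s1_ge0 : 0 <= s1 by apply: sumr_ge0 => j _; apply: le0.
have s2_ge0 : 0 <= s2 by apply: sumr_ge0 => j _; apply: le0.
move=> s_le0; have : s1 + s2 == 0 by rewrite eq_le s_le0 addr_ge0.
by rewrite paddr_eq0 // => /andP[/eqP e1 /eqP e2]; split; apply: sum0.
Qed.

(* The part [W Pi] of the certificate carried by the row space of [G] splits
   along the eigenbasis of the skew pair [(F, e G)] into finite and infinite
   frequencies; the remaining part [W (1 - Pi)] only involves the input. *)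
Lemma certificate_trivial (R : realType) n m k (e a N : 'M[R[i]]_n)
    (b : 'M[R[i]]_(n, m)) (M : 'M[R[i]]_(n + m)) (G : 'M[R[i]]_(n, k))
    (U : 'M[R[i]]_(m, k)) :
    let P := (a *m G + b *m U) *m G ^t* in let W := col_mx G U in
    P *m e ^t* + e *m P ^t* = 0 -> N *m P = 0 ->
    (forall v : 'cV_n, N *m v = 0 -> exists y, v = e *m y) ->
    (forall (x y : 'cV_n) (u : 'cV_m), a *m x + b *m u = e *m y ->
       e *m x = 0 \/ (exists2 z : R[i], z^* = - z & y = z *: x) ->
       col_mx x u != 0 -> ((col_mx x u) ^t* *m M *m col_mx x u) 0 0 < 0) ->
    (forall u : 'cV_m, u != 0 ->
       ((col_mx 0 u) ^t* *m M *m col_mx 0 u) 0 0 < 0) ->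
    0 <= \tr (W *m W ^t* *m M) -> W = 0.
Proof.
move=> P W skewP NP rangeN negfin neginf trge.
have [Gp [GGpG herm]] := crow_space_projector G.
set Pi := Gp *m G in herm.
have GPi : G *m Pi = G by rewrite mulmxA.
have PiPi : Pi *m Pi = Pi by rewrite {1}/Pi -mulmxA GPi.
have PiE : Pi = G ^t* *m Gp ^t* by rewrite -herm cadjM.
(* Reducing [U] to [U Pi] keeps [F G^* = P], and [Pi = G^* Gp^*] makes [F = P Gp^*], so that
   [N F = 0] follows from [N P = 0]. *)
clearbody Pi; pose F := (a *m G + b *m U) *m Pi.
have FG : F *m G ^t* = P by rewrite -mulmxA -{1}herm -cadjM GPi.
have NF : N *m F = 0 by rewrite /F PiE (mulmxA _ (G ^t*)) -/P mulmxA NP mul0mx.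
have colF (v : 'cV_k) : F *m v = a *m (G *m v) + b *m (U *m Pi *m v).
  by rewrite /F -mulmxA mulmxDl -!mulmxA (mulmxA G) GPi.
clearbody F P; have GF : G *m F ^t* = P ^t* by rewrite -FG cadjM cadjK.
have [|V VV eigV] := @cskew_pair_eigenbasis R n k F (e *m G).
  by rewrite cadjM mulmxA FG -(mulmxA e) GF.
(* [Pi] and its complement split the Gram matrix without cross terms, and the unitary [V] drops
   out. *)
have WE : W *m Pi *m V *m (W *m Pi *m V) ^t* +
    W *m (1%:M - Pi) *m (W *m (1%:M - Pi)) ^t* = W *m W ^t*.
  have -> : W *m Pi *m V *m (W *m Pi *m V) ^t* = W *m Pi *m W ^t*.
    rewrite (cadjM _ V) mulmxA -(mulmxA _ V) VV mulmx1 cadjM herm mulmxA.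
    by rewrite -(mulmxA W) PiPi.
  have -> : W *m (1%:M - Pi) *m (W *m (1%:M - Pi)) ^t* = W *m (1%:M - Pi) *m W ^t*.
    rewrite cadjM cadjD cadjN cadj1 herm mulmxA -(mulmxA W).
    by rewrite mulmxBr mulmx1 mulmxBl mul1mx PiPi subrr subr0.
  by rewrite -mulmxDl -mulmxDr addrC subrK mulmx1.
have [|||W1 W2] := @gram_sum_neg _ _ _ _ (W *m Pi *m V) (W *m (1%:M - Pi)) M.
- move=> j.
  have -> : col j (W *m Pi *m V) = col_mx (G *m col j V) (U *m Pi *m col j V).
    by rewrite !colE -mulmxA -mulmxA (mulmxA Pi) mul_col_mx !mulmxA GPi.
  have [y Fy] : exists y, F *m col j V = e *m y.
    by apply: rangeN; rewrite mulmxA NF mul0mx.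
  case: (eigV j) => [eG0|[z zi Fz]].
    apply: (negfin _ y); first by rewrite -colF.
    by left; rewrite mulmxA.
  apply: (negfin _ (z *: (G *m col j V))); last by right; exists z.
  by rewrite -colF Fz -scalemxAr mulmxA.
- move=> j.
  have -> : col j (W *m (1%:M - Pi)) = col_mx 0 (U *m (1%:M - Pi) *m delta_mx j 0).
    rewrite colE mul_col_mx mul_col_mx; congr col_mx.
    by rewrite mulmxBr mulmx1 GPi subrr mul0mx.
  move=> nz; apply: neginf; apply: contra nz => /eqP ->; by rewrite col_mx0.
- by rewrite WE.
have WPi : W *m Pi = 0.
  by rewrite -[LHS]mulmx1 -VV mulmxA W1 mul0mx.
by rewrite -[LHS]mulmx1 -(subrK Pi 1%:M) mulmxDr W2 WPi addr0.
Qed.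

(** * The strict matrix inequality from dissipation at every frequency *)

Section StrictLMI.
Variables (R : realType) (n m : nat).
Variables (E A : 'M[R]_n) (B : 'M[R]_(n, m)) (C : 'M[R]_(m, n)) (D : 'M[R]_m).
Local Notation K := R[i].

(** Here [y] is the velocity of [x]; the two alternatives are infinite frequency, [E x = 0], and a
    finite imaginary frequency [z]. *)
Definition frequency_dissipative :=
  forall (x y : 'cV[K]_n) (u : 'cV[K]_m),
    complexmx A *m x + complexmx B *m u = complexmx E *m y ->
    complexmx E *m x = 0 \/ (exists2 z : K, z^* = - z & y = z *: x) ->
    col_mx x u != 0 -> 0 < dissipation C D x u.

Hypothesis dissip : frequency_dissipative.
Hypothesis DD : posdefmx (D + D^T).

Lemma dissipation_input (u : 'cV[K]_m) : u != 0 -> 0 < dissipation C D 0 u.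
Proof.
move=> u0; have := complexmx_form_gt0 DD u0.
rewrite complexmxD -complexmx_adj /dissipation mulmx0 add0r cadjM.
by rewrite mulmxDr mulmxDl -[X in X + _]mulmxA mxE.
Qed.

Lemma real_certificate_trivial (Z : 'M[R]_(n + m)) :
    possemidefmx Z ->
    (forall X, E^T *m X = X^T *m E -> \tr (Z *m storage_mx A B X) = 0) ->
    0 <= \tr (Z *m supply_mx C D) -> Z = 0.
Proof.
move=> Zpsd Zort trge; have [Zsym _] := Zpsd.
have [||W ZW] := @cpsd_factor R _ (complexmx Z).
- by rewrite complexmx_adj Zsym.
- by move=> x; apply: complexmx_form_ge0.
apply: (@complexmx_inj R); rewrite complexmx0 ZW.
pose G := usubmx W; pose U := dsubmx W.
have WE : W = col_mx G U by rewrite vsubmxK.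
have Z11 : complexmx (ulsubmx Z) = G *m G ^t*.
  by rewrite [LHS]map_ulsubmx -/(complexmx Z) ZW WE cadj_col_mx mul_col_row block_mxKul.
have Z21 : complexmx (dlsubmx Z) = U *m G ^t*.
  by rewrite [LHS]map_dlsubmx -/(complexmx Z) ZW WE cadj_col_mx mul_col_row block_mxKdl.
pose P := A *m ulsubmx Z + B *m dlsubmx Z.
have PE : (complexmx A *m G + complexmx B *m U) *m G ^t* = complexmx P.
  by rewrite mulmxDl -2!mulmxA -Z11 -Z21 complexmxD 2!complexmxM.
suff -> : W = 0 by rewrite mul0mx.
rewrite WE; apply: (@certificate_trivial R n m _ (complexmx E) (complexmx A)
  (complexmx (cokermx E^T)^T) (complexmx B) (complexmx (supply_mx C D))).
- rewrite PE !complexmx_adj -2!complexmxM -complexmxD certificate_skew //.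
  exact: complexmx0.
- by rewrite PE -complexmxM certificate_range // complexmx0.
- move=> v Nv.
  have /submxP[y vy] : (v^T <= complexmx E^T)%MS.
    rewrite submxE -map_cokermx -/(complexmx (cokermx E^T)).
    by apply/eqP/trmx_inj; rewrite trmx_mul trmxK trmx0 -[RHS]Nv map_trmx.
  exists y^T; apply: trmx_inj; rewrite vy trmx_mul trmxK.
  by rewrite map_trmx.
- move=> x y u Axu Ha nz; rewrite supply_form oppr_lt0; exact: dissip Axu Ha nz.
- by move=> u u0; rewrite supply_form oppr_lt0 dissipation_input.
by rewrite -WE -ZW -complexmxM trace_map_mx ler0c.
Qed.

(** The alternative is applied to the cone of all [s supply + storage X] with [s >= 0]. A uniformly
    negative element rescales to a solution; without one, the separating certificate would be both
    nonzero and trivial. *)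
Lemma strict_lmi_of_dissipation :
  exists X, negdefmx (supply_mx C D + storage_mx A B X) /\ E^T *m X = X^T *m E.
Proof.
pose Kc c := exists s X, [/\ 0 <= s, E^T *m X = X^T *m E &
  c = s *: supply_mx C D + storage_mx A B X].
case: (pselect (exists c t, [/\ Kc c, t < 0 & forall z, qform c z <= t * qform 1%:M z])).
  have pos1 (z : 'cV[R]_(n + m)) : z != 0 -> 0 < qform 1%:M z.
    move=> z0; rewrite lt_neqAle qform1E sumr_ge0 ?andbT => [|i _]; last exact: sqr_ge0.
    apply: contra z0; rewrite eq_sym psumr_eq0 => [/allP h|i _]; last exact: sqr_ge0.
    apply/eqP/colP => i; have := h i (mem_index_enum _).
    by rewrite sqrf_eq0 mxE => /eqP.
  case=> c [t [[s [X [s0 EX ->]]] t0 neg]].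
  have finish a : 0 <= a -> (forall z, z != 0 ->
      qform (supply_mx C D + a *: storage_mx A B X) z < 0) ->
    exists X, negdefmx (supply_mx C D + storage_mx A B X) /\ E^T *m X = X^T *m E.
    move=> a0 lt; exists (a *: X); rewrite storage_mxZ; split; last first.
      by rewrite -scalemxAr EX [in RHS]linearZ /= -scalemxAl.
    split; first by rewrite linearN linearD /= linearZ /= supply_mx_sym storage_mx_sym.
    by move=> z /lt; rewrite -[X in _ -> 0 < X]/(qform _ z) qformN oppr_gt0.
  (* For [s = 0] the storage form is at most [t < 0] times the squared norm, and the factor
     [(k + 1) / - t] makes it outweigh the bound [k] of the supply. For [s > 0] division by [s] is
     enough. *)
  move: s0; rewrite le_eqVlt => /predU1P[s0|s0].
    have [k k0 Hk] := qform_bound (supply_mx C D).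
    have nt0 : 0 < - t by rewrite oppr_gt0.
    apply: (finish ((k + 1) / - t)) => [|z z0].
      by rewrite divr_ge0 ?addr_ge0 ?ler01 // ltW.
    have := neg z; rewrite -s0 scale0r add0r => negz.
    rewrite qformD qformZ; apply: le_lt_trans (_ : _ <= - qform 1%:M z) _; last first.
      by rewrite oppr_lt0 pos1.
    apply: le_trans (lerD (Hk z) (ler_wpM2l _ negz)) _.
      by rewrite divr_ge0 ?addr_ge0 ?ler01 // ltW.
    rewrite mulrA invrN mulrN mulNr mulfVK ?lt_eqF //.
    by rewrite mulNr mulrDl mul1r opprD addrA subrr add0r.
  apply: (finish s^-1) => [|z z0]; first by rewrite invr_ge0 ltW.
  have lt : qform (s *: supply_mx C D + storage_mx A B X) z < 0.
    by apply: le_lt_trans (neg z) _; rewrite nmulr_rlt0 ?pos1.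
  rewrite -[supply_mx C D](scalerK (lt0r_neq0 s0)) -scalerDr qformZ.
  by rewrite pmulr_rlt0 ?invr_gt0.
move=> nex; exfalso.
have st0 : storage_mx A B 0 = 0.
  by rewrite -[0](scale0r (0 : 'M_n)) storage_mxZ scale0r.
have [||||Z [Zpsd Z0 Zge]] := @cone_alternative R (n + m) Kc.
- by exists 0, 0; rewrite mulmx0 trmx0 mul0mx scale0r st0 addr0.
- move=> _ _ [s [X [s0 EX ->]]] [s' [X' [s'0 EX' ->]]]; exists (s + s'), (X + X').
  split; [exact: addr_ge0 | | by rewrite storage_mxD scalerDl addrACA].
  by rewrite mulmxDr EX EX' -mulmxDl [in RHS]linearD.
- move=> a _ a0 [s [X [s0 EX ->]]]; exists (a * s), (a *: X).
  split; [by rewrite mulr_ge0 // ltW | | by rewrite storage_mxZ scalerDr scalerA].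
  by rewrite -scalemxAr EX [in RHS]linearZ /= -scalemxAl.
- move=> c t Kcc neg; rewrite leNgt; apply/negP => t0.
  by apply: nex; exists c, t.
have Kst X : E^T *m X = X^T *m E -> Kc (storage_mx A B X).
  by move=> EX; exists 0, X; rewrite scale0r add0r.
move/negP: Z0; apply; apply/eqP; apply: real_certificate_trivial => //.
  (* Storage terms lie in the cone with both signs, so the certificate is orthogonal to them. *)
  move=> X EX; apply/eqP; rewrite eq_le Zge ?andbT; last exact: Kst.
  rewrite -oppr_ge0 -mulN1r -mxtraceZ scalemxAr -storage_mxZ; apply/Zge/Kst.
  by rewrite -scalemxAr EX [in RHS]linearZ /= -scalemxAl.
by apply: Zge; exists 1, 0; rewrite mulmx0 trmx0 mul0mx scale1r st0 addr0.
Qed.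
End StrictLMI.

(** * Port-Hamiltonian forms *)

Section RealForms.
Variable R : realType.

Lemma posdefmx_congr n (M T : 'M[R]_n) : T \in unitmx ->
  posdefmx (T^T *m M *m T) <-> posdefmx M.
Proof.
move=> Tu; have imp (N U : 'M[R]_n) : U \in unitmx -> posdefmx N -> posdefmx (U^T *m N *m U).
  move=> Uu [Ns Np]; split; first by rewrite !trmx_mul trmxK Ns mulmxA.
  move=> x x0; have := Np (U *m x); rewrite trmx_mul !mulmxA; apply.
  by apply: contra x0 => /eqP/(canRL (mulKmx Uu)) ->; rewrite mulmx0.
split=> [H|]; last exact: imp.
have := imp _ (invmx T) _ H; rewrite unitmx_inv => /(_ Tu).
rewrite -!mulmxA mulmxV // mulmx1 mulmxA -trmx_mul mulmxV // trmx1 mul1mx.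
exact.
Qed.

Lemma posdefmxZ n (M : 'M[R]_n) a : 0 < a -> posdefmx (a *: M) <-> posdefmx M.
Proof.
move=> a0; have imp b (N : 'M[R]_n) : 0 < b -> posdefmx N -> posdefmx (b *: N).
  move=> b0 [Ns Np]; split; first by rewrite linearZ /= Ns.
  by move=> x /Np Nx; rewrite -scalemxAr -scalemxAl mxE mulr_gt0.
split=> [H|]; last exact: imp.
by rewrite -[M](scalerK (lt0r_neq0 a0)); apply: imp; rewrite ?invr_gt0.
Qed.

Lemma posdefmx_semi n (M : 'M[R]_n) : posdefmx M -> possemidefmx M.
Proof.
move=> [Ms Mp]; split=> // x; case: (eqVneq x 0) => [->|/Mp/ltW //].
by rewrite mulmx0 mxE.
Qed.

Lemma posdefmx_ulblock n m (M : 'M[R]_n) P Q (S : 'M[R]_m) :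
  posdefmx (block_mx M P Q S) -> posdefmx M.
Proof.
case=> Ms Mp; split.
  by move: Ms; rewrite tr_block_mx => /eq_block_mx[].
move=> x x0; have := Mp (col_mx x 0).
rewrite tr_col_mx trmx0 -mulmxA mul_block_col mul_row_col !mulmx0 !mul0mx !addr0 mulmxA.
apply; apply: contra x0 => /eqP; rewrite -[X in _ = X]col_mx0.
by move=> /eq_col_mx[-> _].
Qed.

Lemma posdefmx_drblock n m (M : 'M[R]_n) P Q (S : 'M[R]_m) :
  posdefmx (block_mx M P Q S) -> posdefmx S.
Proof.
case=> Ms Mp; split.
  by move: Ms; rewrite tr_block_mx => /eq_block_mx[].
move=> x x0; have := Mp (col_mx 0 x).
rewrite tr_col_mx trmx0 -mulmxA mul_block_col mul_row_col !mulmx0 !mul0mx !add0r mulmxA.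
apply; apply: contra x0 => /eqP; rewrite -[X in _ = X]col_mx0.
by move=> /eq_col_mx[_ ->].
Qed.

Lemma unitmx_of_injective (F : fieldType) n (X : 'M[F]_n) :
  (forall v : 'cV_n, X *m v = 0 -> v = 0) -> X \in unitmx.
Proof.
move=> inj; rewrite -unitmx_tr -row_free_unit -kermx_eq0; apply/rowV0P => y /sub_kermxP yX.
by apply: trmx_inj; rewrite trmx0; apply: inj; rewrite -[LHS]trmxK trmx_mul trmxK yX trmx0.
Qed.

Lemma negdefmx_lyapunov_unit n (A X : 'M[R]_n) :
  negdefmx (A^T *m X + X^T *m A) -> X \in unitmx.
Proof.
case=> _ neg; apply: unitmx_of_injective => v Xv; apply/eqP/negP => /negP /neg.
have vX : v^T *m X^T = 0 by rewrite -trmx_mul Xv trmx0.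
rewrite mulmxN mulNmx mulmxDr mulmxDl -!mulmxA Xv !mulmx0 add0r mulmxA vX mul0mx.
by rewrite oppr0 mxE ltxx.
Qed.
End RealForms.

Section PortHamiltonian.
Variables (R : realType) (n m : nat).
Variables (E A : 'M[R]_n) (B : 'M[R]_(n, m)) (C : 'M[R]_(m, n)) (D : 'M[R]_m).
Local Notation lmi X := (block_mx (A^T *m X + X^T *m A) (X^T *m B - C^T)
                             (B^T *m X - C)        (- D - D^T)).

(** The skew [J] and [N] cancel in the diagonal blocks and [F] in the off-diagonal ones, leaving
    twice the cost matrix up to the congruence by [diag(Q, 1)]. *)
Lemma lmi_cost_matrix (J Rm Q : 'M[R]_n) (F P : 'M[R]_(n, m)) (S N : 'M[R]_m) :
    A = (J - Rm) *m Q -> B = F - P -> C = (F + P)^T *m Q -> D = S + N ->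
    J^T = - J -> N^T = - N -> Rm^T = Rm -> S^T = S ->
  - lmi Q = (block_mx Q 0 0 1%:M)^T *m (2 *: cost_matrix Rm P S) *m block_mx Q 0 0 1%:M.
Proof.
move=> -> -> -> -> Js Ns Rs Ss.
have JR : (J - Rm)^T = - J - Rm by rewrite linearB /= Js Rs.
have FP : (F + P)^T = F^T + P^T by rewrite linearD.
have FmP : (F - P)^T = F^T - P^T by rewrite linearB.
have SN : (S + N)^T = S - N by rewrite linearD /= Ss Ns.
rewrite opp_block_mx tr_block_mx !trmx0 trmx1 /cost_matrix scale_block_mx.
rewrite !mulmx_block !mul0mx !mulmx0 !mul1mx !mulmx1 !addr0 !add0r.
have two k l (V : 'M[R]_(k, l)) : 2 *: V = V + V by rewrite scaler_nat mulr2n.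
rewrite !trmx_mul !trmxK JR FmP SN FP; congr block_mx.
- rewrite [Q^T *m (_ *m Q)]mulmxA -mulmxDl -mulmxDr -mulNmx -mulmxN two.
  by rewrite addrACA addNr add0r opprD !opprK.
- rewrite -mulmxBr -mulmxN two; congr (_ *m _).
  by rewrite (opprD F) addrACA subrr add0r opprD !opprK.
- rewrite -mulmxBl -mulNmx two; congr (_ *m _).
  by rewrite (opprD F^T) addrACA subrr add0r opprD !opprK.
- by rewrite two opprD !opprK addrACA subrr addr0.
Qed.

(** With [Q = X], invertible because of the upper left block, [A X^-1] and [D] split into skew and
    symmetric parts, and [F], [P] are the half sum and half difference of [X^-T C^T] and [B]. *)
Lemma ph_form_of_lmi X : negdefmx (lmi X) -> E^T *m X = X^T *m E ->
  possemidefmx (E^T *m X) -> admits_ph_form_posdef_cost E A B C D.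
Proof.
move=> neg EX EXp.
have Xu : X \in unitmx.
  apply: (@negdefmx_lyapunov_unit R n A); move: neg.
  by rewrite /negdefmx opp_block_mx => /posdefmx_ulblock.
pose M := A *m invmx X; pose Y := (invmx X)^T *m C^T.
pose h : R := 2^-1.
pose J := h *: (M - M^T); pose Rm := - (h *: (M + M^T)).
pose F := h *: (Y + B); pose P := h *: (Y - B).
pose S := h *: (D + D^T); pose N := h *: (D - D^T).
have hh k l (V : 'M[R]_(k, l)) : h *: V + h *: V = V.
  by rewrite -scalerDl -mulr2n -mulr_natr mulVf ?pnatr_eq0 // scale1r.
have e1 : A = (J - Rm) *m X.
  rewrite opprK -scalerDr addrA [M - _ + M]addrAC subrK scalerDr hh.
  by rewrite mulmxKV.
have e2 : B = F - P.
  by rewrite -scalerBr opprB addrC addrA subrK scalerDr hh.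
have e3 : C = (F + P)^T *m X.
  rewrite -scalerDr addrACA subrr addr0 scalerDr hh trmx_mul !trmxK.
  by rewrite mulmxKV.
have e4 : D = S + N.
  by rewrite -scalerDr addrACA subrr addr0 scalerDr hh.
have Js : J^T = - J by rewrite linearZ /= linearB /= trmxK -scalerN opprB.
have Ns : N^T = - N by rewrite linearZ /= linearB /= trmxK -scalerN opprB.
have Rs : Rm^T = Rm by rewrite linearN /= linearZ /= linearD /= trmxK addrC.
have Ss : S^T = S by rewrite linearZ /= linearD /= trmxK addrC.
have Kp : posdefmx (cost_matrix Rm P S).
  move: neg; rewrite /negdefmx (lmi_cost_matrix e1 e2 e3 e4) //.
  by rewrite posdefmx_congr ?posdefmxZ // unitmxE det_ublock det1 mulr1 -unitmxE.
exists J, Rm, X, F, P, S, N; split=> //; split=> //.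
  by rewrite -EX.
split; apply: posdefmx_semi => //.
  exact: posdefmx_ulblock Kp.
exact: posdefmx_drblock Kp.
Qed.

Lemma lmi_of_ph_form : admits_ph_form_posdef_cost E A B C D ->
  exists X, [/\ negdefmx (lmi X), E^T *m X = X^T *m E & possemidefmx (E^T *m X)].
Proof.
case=> J [Rm [Q [F [P [S [N [[[e1 e2 e3 e4] [Js Ns] Qu [EQ EQp] [[Rs _] [Ss _] _]] Kp]]]]]]].
exists Q; split=> //; last by rewrite -EQ.
rewrite /negdefmx (lmi_cost_matrix e1 e2 e3 e4) //.
by rewrite posdefmx_congr ?posdefmxZ // unitmxE det_ublock det1 mulr1 -unitmxE.
Qed.
End PortHamiltonian.

(** * From the linear matrix inequality to positive realness *)

Section FrequencyDomain.
Variables (R : realType) (n m : nat).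
Variables (E A : 'M[R]_n) (B : 'M[R]_(n, m)) (C : 'M[R]_(m, n)) (D : 'M[R]_m).
Local Notation K := R[i].
Local Notation cE := (complexmx E).
Local Notation cA := (complexmx A).

Lemma dissipation_gain (G : 'M[K]_m) (x : 'cV[K]_n) (u : 'cV[K]_m) :
  complexmx C *m x + complexmx D *m u = G *m u ->
  dissipation C D x u = (u ^t* *m (G + G ^t*) *m u) 0 0.
Proof.
rewrite /dissipation => ->; rewrite cadjM mulmxDr mulmxDl -[X in X + _ *m _]mulmxA.
by rewrite [RHS]mxE.
Qed.

Lemma dissipation0 (x : 'cV[K]_n) : dissipation C D x 0 = 0.
Proof.
rewrite /dissipation cadj0 mul0mx; move: (_ + _ *m 0) => y.
by rewrite mulmx0 mxE addr0.
Qed.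

Lemma resolvent_state s (u : 'cV[K]_m) : s *: cE - cA \in unitmx ->
  let x := invmx (s *: cE - cA) *m (complexmx B *m u) in
  cA *m x + complexmx B *m u = cE *m (s *: x).
Proof.
move=> su x; have : (s *: cE - cA) *m x = complexmx B *m u by rewrite mulKVmx.
rewrite mulmxBl -scalemxAl scalemxAr => <-.
by rewrite addrC subrK.
Qed.

Lemma resolvent_stateP s (x : 'cV[K]_n) (u : 'cV[K]_m) : s *: cE - cA \in unitmx ->
  cA *m x + complexmx B *m u = cE *m (s *: x) ->
  x = invmx (s *: cE - cA) *m (complexmx B *m u).
Proof.
move=> su /(canRL (addKr _)) ->; rewrite -scalemxAr scalemxAl [- _ + _]addrC -mulmxBl.
by rewrite mulKmx.
Qed.

Lemma transfer_output s (x : 'cV[K]_n) (u : 'cV[K]_m) : \det (s *: cE - cA) != 0 ->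
  cA *m x + complexmx B *m u = cE *m (s *: x) ->
  complexmx C *m x + complexmx D *m u = transfer_at E A B C D s *m u.
Proof.
move=> ds Ax; have su : s *: cE - cA \in unitmx by rewrite unitmxE unitfE.
rewrite (transfer_at_resolvent B C D ds).2 {1}(resolvent_stateP su Ax).
by rewrite mulmxDl !mulmxA.
Qed.

Lemma complexmx_conj k l (M : 'M[R]_(k, l)) : map_mx Num.conj (complexmx M) = complexmx M.
Proof. by apply/matrixP => i j; rewrite !mxE conj_Creal // complex_real. Qed.

(** The coefficients are real. Conjugation reflects frequency [w] to [- w], whereas positive
    realness is assumed only for [w >= 0]. *)
Lemma dissipation_conj (x : 'cV[K]_n) (u : 'cV[K]_m) :
  dissipation C D (map_mx Num.conj x) (map_mx Num.conj u) = (dissipation C D x u)^*.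
Proof.
have e : complexmx C *m map_mx Num.conj x + complexmx D *m map_mx Num.conj u =
    map_mx Num.conj (complexmx C *m x + complexmx D *m u).
  by rewrite map_mxD !map_mxM !complexmx_conj.
rewrite /dissipation e; move: (complexmx C *m x + _) => y.
by rewrite rmorphD !map_trmx -!map_mxM !mxE.
Qed.

Lemma stable_det_neq0 s : asymptotically_stable E A -> 0 <= complex.Re s ->
  \det (s *: cE - cA) != 0.
Proof.
move=> stab s0; apply/negP => d0.
have /stab : finite_eigenvalue E A s by rewrite /finite_eigenvalue /root det_pencil_horner.
by rewrite ltNge s0.
Qed.
End FrequencyDomain.

(** * Positive realness as dissipation at every frequency *)

Lemma transfer_at_infinity_unique (R : realType) n m (E A : 'M[R]_n) B C (D : 'M[R]_m) L L' :
  @transfer_at_infinity R n m E A B C D L -> transfer_at_infinity E A B C D L' -> L = L'.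
Proof.
move=> HL HL'; apply/matrixP => i j; have [rL iL] := HL i j; have [rL' iL'] := HL' i j.
have := cvg_unique _ rL rL'; have := cvg_unique _ iL iL'.
move=> /(_ (@Rhausdorff R)) ei /(_ (@Rhausdorff R)) er.
by move: er ei; case: (L i j) => a b; case: (L' i j) => c d /= -> ->.
Qed.

(** The output is [G(i w) u] at a finite frequency and the value at infinity applied to [u] when
    [E x = 0]; the Hermitian parts of both gains are positive definite. *)
Lemma frequency_dissipative_of_espr (R : realType) n m (E A : 'M[R]_n)
    (B : 'M[R]_(n, m)) (C : 'M[R]_(m, n)) (D : 'M[R]_m) :
  admissible E A -> extended_strictly_positive_real E A B C D ->
  frequency_dissipative E A B C D.
Proof.
move=> [_ [nu idx nu1] stab] [[_ _ pr] [L HL [_ Lp]]].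
have [q [r [qr [W [T [J [Wu Tu EE AE HJ]]]]]]] := has_index_le1_form idx nu1.
subst n; rewrite castmx_id in EE; rewrite castmx_id in AE.
have imag_unit w : \det ((0 +i* w)%C *: complexmx E - complexmx A) != 0.
  exact: stable_det_neq0.
have LE := transfer_at_infinity_unique HL
  (transfer_at_infinity_feedthrough Wu Tu EE AE B C D stab).
have pos w x u : 0 <= w -> u != 0 ->
    complexmx A *m x + complexmx B *m u = complexmx E *m ((0 +i* w)%C *: x) ->
    0 < dissipation C D x u.
  move=> w0 u0 Ax; rewrite (dissipation_gain (transfer_output C D (imag_unit w) Ax)).
  by have [_] := pr w w0; apply.
(* Without input [x] would be nonzero, which index at most one forbids when [E x = 0], and stability
   forbids at an imaginary frequency. *)
move=> x y u Axu Ha nz; case: (eqVneq u 0) => [u0|u0].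
  have x0 : x != 0 by apply: contra nz => /eqP ->; rewrite u0 col_mx0.
  case/negP: x0; apply/eqP; move: Axu; rewrite u0 mulmx0 addr0 => Ax.
  case: Ha => [Ex|[[a b] ab yx]]; first exact: (index_one_injective Wu Tu EE AE Ex Ax).
  have a0 : a = 0.
    by move: ab => [/eqP]; rewrite -addr_eq0 -mulr2n mulrn_eq0 => /eqP.
  have su := imag_unit b; move: yx Ax; rewrite a0 => -> Ax.
  have : ((0 +i* b)%C *: complexmx E - complexmx A) *m x = 0.
    by rewrite mulmxBl -scalemxAl scalemxAr Ax subrr.
  move/(canRL (mulKmx _)); rewrite mulmx0; apply.
  by rewrite unitmxE unitfE.
case: Ha => [Ex|[[a b] ab yx]].
  have := feedthroughE Wu Tu EE AE C D Ex Axu; rewrite -LE => /dissipation_gain ->.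
  exact: Lp.
have a0 : a = 0.
  by move: ab => [/eqP]; rewrite -addr_eq0 -mulr2n mulrn_eq0 => /eqP.
rewrite a0 in yx; subst y; case: (leP 0 b) => b0; first exact: pos Axu.
rewrite lt_def -conjC_eq0 -conjC_ge0 -lt_def -dissipation_conj.
apply: (pos (- b)); first by rewrite oppr_ge0 ltW.
  by rewrite map_mx_eq0.
have := congr1 (map_mx Num.conj) Axu.
rewrite map_mxD !map_mxM !complexmx_conj map_mxZ => ->.
by congr (_ *m (_ *: _)); rewrite /= oppr0.
Qed.

(** * Consequences of the linear matrix inequality *)

Section FromLMI.
Variables (R : realType) (n m : nat).
Variables (E A : 'M[R]_n) (B : 'M[R]_(n, m)) (C : 'M[R]_(m, n)) (D : 'M[R]_m).
Variable X : 'M[R]_n.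
Hypothesis neg : negdefmx (supply_mx C D + storage_mx A B X).
Hypothesis EX : E^T *m X = X^T *m E.
Hypothesis EXp : possemidefmx (E^T *m X).
Local Notation K := R[i].
Local Notation cE := (complexmx E).
Local Notation cA := (complexmx A).

(** This is the matrix inequality at [(x, u)] read as a power balance. *)
Lemma lmi_dissipation (x : 'cV[K]_n) (u : 'cV[K]_m) : col_mx x u != 0 ->
  ((col_mx x u) ^t* *m complexmx (storage_mx A B X) *m col_mx x u) 0 0 <
  dissipation C D x u.
Proof.
move=> /(complexmx_form_gt0 neg).
rewrite complexmxN complexmxD mulmxN mulNmx mulmxDr mulmxDl mxE [X in - X]mxE.
by rewrite supply_form opprD opprK subr_gt0.
Qed.

Lemma lmi_dissipative : frequency_dissipative E A B C D.
Proof.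
move=> x y u Axu Ha nz; rewrite -(storage_form0 EX Axu Ha).
exact: lmi_dissipation.
Qed.

(** Zero input supplies no power, so a nonzero state at infinite frequency would contradict strict
    dissipation. *)
Lemma lmi_index_injective (v w : 'cV[K]_n) : cE *m v = 0 -> cA *m v = cE *m w -> v = 0.
Proof.
move=> Ev Av; apply/eqP/negP => /negP v0.
have : 0 < dissipation C D v (0 : 'cV_m).
  apply: (@lmi_dissipative _ w); first by rewrite mulmx0 addr0.
    by left.
  by apply: contraNneq v0; rewrite -[X in _ = X]col_mx0 => /eq_col_mx[->].
by rewrite dissipation0 ltxx.
Qed.

(** If [A x = s E x] with zero input, the storage term is [2 Re s] times [x^* E^T X x], hence
    nonnegative, while the power balance makes it negative unless [x = 0]. *)
Lemma lmi_det_neq0 (s : K) : 0 <= complex.Re s -> \det (s *: cE - cA) != 0.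
Proof.
move=> s0; rewrite -unitfE -unitmxE; apply: unitmx_of_injective => x.
rewrite mulmxBl -scalemxAl => /eqP; rewrite subr_eq0 => /eqP sE.
apply/eqP/negP => /negP x0.
have nz : col_mx x (0 : 'cV[K]_m) != 0.
  by apply: contraNneq x0; rewrite -[X in _ = X]col_mx0 => /eq_col_mx[->].
have := lmi_dissipation nz; rewrite storage_form dissipation0 mulmx0 addr0 -sE.
have := complexmx_form_ge0 x EXp; set H := complexmx (E^T *m X).
have h1 : (complexmx X) ^t* *m cE = H by rewrite complexmx_adj -complexmxM -EX.
have h2 : cE ^t* *m complexmx X = H by rewrite complexmx_adj -complexmxM.
clearbody H; move: (complexmx X) cE h1 h2 {sE} => Y e h1 h2 H0.
have -> : x ^t* *m Y ^t* *m (s *: (e *m x)) = s *: (x ^t* *m H *m x).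
  by rewrite -scalemxAr mulmxA -(mulmxA (x ^t*) _ e) h1.
have -> : (s *: (e *m x)) ^t* *m Y *m x = s^* *: (x ^t* *m H *m x).
  by rewrite cadjZ cadjM -2!scalemxAl -(mulmxA (x ^t*) _ Y) h2.
rewrite mxE [X in _ + X]mxE -mulrDl le_gtF // mulr_ge0 //.
by case: s s0 => a b /= a0; rewrite lecE /= addrN eqxx addr_ge0.
Qed.

Lemma lmi_stable : asymptotically_stable E A.
Proof.
move=> s; rewrite /finite_eigenvalue /root det_pencil_horner => d0.
rewrite ltNge; apply/negP => /lmi_det_neq0; by rewrite (eqP d0) eqxx.
Qed.

Lemma lmi_admissible : admissible E A.
Proof.
split; last exact: lmi_stable.
  by exists 0; apply: lmi_det_neq0.
exact: index_le1_of_injective lmi_index_injective.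
Qed.

Lemma gain_hermposdef (G : 'M[K]_m) :
    (forall u : 'cV_m, u != 0 -> 0 < (u ^t* *m (G + G ^t*) *m u) 0 0) ->
  hermposdefmx (G + G ^t*).
Proof. by move=> Gp; split=> //; rewrite cadjD cadjK addrC. Qed.

Lemma lmi_strictly_positive_real : strictly_positive_real E A B C D.
Proof.
split=> [|s s0|w w0]; first by have [] := lmi_admissible.
  exact: (transfer_at_resolvent B C D (lmi_det_neq0 s0)).1.
have ds : \det ((0 +i* w)%C *: cE - cA) != 0 by apply: lmi_det_neq0.
have su : (0 +i* w)%C *: cE - cA \in unitmx by rewrite unitmxE unitfE.
apply: gain_hermposdef => u u0; have Ax := resolvent_state B u su.
rewrite -(dissipation_gain (transfer_output C D ds Ax)).
apply: lmi_dissipative Ax _ _.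
  right; exists (0 +i* w)%C => //.
  by apply/eqP; rewrite eq_complex /= oppr0 !eqxx.
by apply: contraNneq u0; rewrite -[X in _ = X]col_mx0 => /eq_col_mx[_ ->].
Qed.

(** Every input admits a state with [E x = 0]; dissipation is strict there, and the output is
    [feedthrough] applied to the input. *)
Lemma lmi_extended_strictly_positive_real : extended_strictly_positive_real E A B C D.
Proof.
split; first exact: lmi_strictly_positive_real.
have [_ [nu idx nu1] stab] := lmi_admissible.
have [q [r [qr [W [T [J [Wu Tu EE AE HJ]]]]]]] := has_index_le1_form idx nu1.
have dis := lmi_dissipative.
move: dis; clear -EE AE Wu Tu stab => dis.
subst n; rewrite castmx_id in EE; rewrite castmx_id in AE.
exists (feedthrough W T B C D).
  exact: transfer_at_infinity_feedthrough Wu Tu EE AE B C D stab.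
apply: gain_hermposdef => u u0.
have [x [y [Ex Axu]]] := feedthrough_state Wu Tu EE AE B u.
rewrite -(dissipation_gain (feedthroughE Wu Tu EE AE C D Ex Axu)).
apply: dis Axu _ _; first by left.
by apply: contraNneq u0; rewrite -[X in _ = X]col_mx0 => /eq_col_mx[_ ->].
Qed.

Lemma lmi_posdef_feedthrough : posdefmx (D + D^T).
Proof.
have := neg; rewrite /negdefmx add_block_mx opp_block_mx => /posdefmx_drblock.
by rewrite addr0 opprD !opprK.
Qed.
End FromLMI.

Lemma lyapunov_admissible (R : realType) n (E A X : 'M[R]_n) :
    admissible E A -> negdefmx (A^T *m X + X^T *m A) -> E^T *m X = X^T *m E ->
  possemidefmx (E^T *m X).
Proof.
move=> [_ [nu idx nu1] stab] neg EX.
have [q [r [qr [W [T [J [Wu Tu EE AE HJ]]]]]]] := has_index_le1_form idx nu1.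
subst n; rewrite castmx_id in EE; rewrite castmx_id in AE.
exact (lyapunov_descriptor Tu EE AE HJ stab neg EX).
Qed.

Theorem theorem6 (R : realType) (n m : nat) (E A : 'M[R]_n)
    (B : 'M[R]_(n, m)) (C : 'M[R]_(m, n)) (D : 'M[R]_m) :
  let statement1 :=
    [/\ admissible E A, extended_strictly_positive_real E A B C D
      & posdefmx (D + D^T)] in
  let statement2 :=
    exists X : 'M[R]_n,
      [/\ negdefmx (block_mx (A^T *m X + X^T *m A) (X^T *m B - C^T)
                             (B^T *m X - C)        (- D - D^T)),
          E^T *m X = X^T *m E
        & possemidefmx (E^T *m X)] in
  let statement3 := admits_ph_form_posdef_cost E A B C D in
  (statement1 <-> statement2) /\ (statement2 <-> statement3).
Proof.
split; split.
- move=> [adm espr DD].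
  have [X [neg EX]] :=
    strict_lmi_of_dissipation (frequency_dissipative_of_espr adm espr) DD.
  (* Separation gives only the symmetry of [E^T X]; its sign follows from admissibility and the
     upper left block. *)
  exists X; rewrite lmi_split; split=> //; apply: lyapunov_admissible adm _ EX.
  move: neg; rewrite -lmi_split /negdefmx opp_block_mx; exact: posdefmx_ulblock.
- move=> [X []]; rewrite lmi_split => neg EX EXp; split.
  + exact: lmi_admissible neg EX EXp.
  + exact: lmi_extended_strictly_positive_real neg EX EXp.
  + exact: lmi_posdef_feedthrough neg.
- by move=> [X [neg EX EXp]]; exact: ph_form_of_lmi neg EX EXp.
- exact: lmi_of_ph_form.
Qed.
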